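(* Let $(M,\omega)$ be a symplectic manifold, let $E=E^+\oplus E^-$ be a $\mathbb{Z}_2$-graded smooth superbundle over $M$, and let $\mathbb{A}$ be a primitive superconnection on $\Omega(M,E)\oplus\Omega(M,E)$. For any $k\in\mathbb{N}$, we have $\left[\!\left[\mathbb{A},\mathbb{A}^{2k}\right]\!\right]=(0,0)$, where $\mathbb{A}^{2k}$ is regarded as an element of $\Omega^+(M,\mathrm{End}(E))\oplus\Omega^-(M,\mathrm{End}(E))$.
   Context: Forms. $\Omega(M)$ is the space of smooth differential forms on $M$; $\Omega(M,E)$ and $\Omega(M,\mathrm{End}(E))$ are the spaces of smooth forms with values in $E$ and $\mathrm{End}(E)$. Here $\mathrm{End}^+(E)=\mathrm{Hom}(E^+,E^+)\oplus\mathrm{Hom}(E^-,E^-)$ and $\mathrm{End}^-(E)=\mathrm{Hom}(E^+,E^-)\oplus\mathrm{Hom}(E^-,E^+)$. The total degree of $\alpha\otimes v$ is $|\alpha|+|v|$, the form degree plus the $\mathbb{Z}_2$-degree of $v$; $\Omega^+$ (resp. $\Omega^-$) denotes the subspace of even (resp. odd) total degree. Signs. For forms $\alpha,\beta$ and homogeneous sections $L,K$ of $\mathrm{End}(E)$ and $v$ of $E$: $(\alpha\otimes L)(\beta\otimes v)=(-1)^{|L||\beta|}(\alpha\wedge\beta)\otimes L(v)$ and $(\beta\otimes K)(\alpha\otimes L)=(-1)^{|K||\alpha|}(\beta\wedge\alpha)\otimes(KL)$. Superconnections. A superconnection on $E$ is a first-order differential operator $A$ on $\Omega(M,E)$ mapping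 $\Omega^\pm(M,E)$ to $\Omega^\mp(M,E)$ with $A(\alpha\wedge\eta)=d\alpha\wedge\eta+(-1)^{|\alpha|}\alpha\wedge A\eta$ for $\alpha\in\Omega(M)$, $\eta\in\Omega(M,E)$. A primitive superconnection is a linear map $\mathbb{A}:\Omega(M,E)\oplus\Omega(M,E)\to\Omega(M,E)\oplus\Omega(M,E)$ of the form $\mathbb{A}(\alpha,\beta)=(A\alpha+\omega\wedge\beta,\ B\alpha-A\beta)$ with $A$ a superconnection on $E$ and $B\in\Omega^+(M,\mathrm{End}(E))$. Identification of $\mathbb{A}^{2k}$. Write a differential operator $D$ on $\Omega(M,E)=\Omega^+(M,E)\oplus\Omega^-(M,E)$ as a block matrix $D=\begin{bmatrix} D_1 & D_2 \\ D_3 & D_4 \end{bmatrix}$ and $\alpha=\alpha^++\alpha^-$. If $D(\beta\wedge\alpha)=\beta\wedge D_1\alpha^++(-1)^{|\beta|}\beta\wedge D_2\alpha^-+(-1)^{|\beta|}\beta\wedge D_3\alpha^++\beta\wedge D_4\alpha^-$ for all $\beta\in\Omega(M)$, $\alpha\in\Omega(M,E)$, then $D$ is identified with the unique element of $\Omega(M,\mathrm{End}(E))$ whose action is $D$. If $D,\tilde D$ both satisfy this and $\mathbb{D}(\alpha,\beta)=(D\alpha,\ \tilde D\alpha+D_1\beta^+-D_2\beta^--D_3\beta^++D_4\beta^-)$, then $\mathbb{D}$ is identified with the pair $(D,\tilde D)$. Explicitly, for $k\ge1$ the $2k$-fold composition $\mathbb{A}^{2k}$ is identified with $$\left((A^2+\omega\wedge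 B)^k,\ \sum_{i=0}^{k-1}(A^2+\omega\wedge B)^i(BA-AB)(A^2+\omega\wedge B)^{k-1-i}\right).$$ Commutators. For $\alpha\in\Omega(M,\mathrm{End}(E))$ of homogeneous total degree, $[A,\alpha]=A\alpha-(-1)^{|\alpha|}\alpha A$ (as operators on $\Omega(M,E)$; this is again identified with an element of $\Omega(M,\mathrm{End}(E))$), extended linearly. For $(\alpha,\beta)\in\Omega(M,\mathrm{End}(E))\oplus\Omega(M,\mathrm{End}(E))$, $$\left[\!\left[\mathbb{A},(\alpha,\beta)\right]\!\right]=\left([A,\alpha]+\omega\wedge\beta,\ B\alpha-\alpha B-[A,\beta]\right).$$ *)

(* Defs.v *)
From HB Require Import structures.
From mathcomp Require Import all_boot all_order all_algebra.
From mathcomp Require Import all_classical all_reals all_analysis.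
Set Implicit Arguments.
Unset Strict Implicit.
Unset Printing Implicit Defensive.
Import Order.TTheory GRing.Theory Num.Theory.
Import numFieldNormedType.Exports.
Local Open Scope classical_set_scope.
Local Open Scope ring_scope.

Definition iter_derive (R : realType) (n : nat) (vs : seq 'rV[R]_n)
    (f : 'rV[R]_n -> R) : 'rV[R]_n -> R :=
  foldr (fun v g => 'D_v g) f vs.

(* For O open this says that f is C^oo on O: all iterated directional
   derivatives exist on O and are (Frechet) differentiable there. *)
Definition smooth_on (R : realType) (n : nat) (O : set 'rV[R]_n)
    (f : 'rV[R]_n -> R) : Prop :=
  forall (vs : seq 'rV[R]_n) (x : 'rV[R]_n), O x ->
    differentiable (iter_derive vs f) x.

(* The atlas is indexed by the points of M: [chart p] is a chart around p, with
   domain [cdom p] and inverse [unchart p] (both maps are total, with irrelevant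
   values outside [cdom p] and its image). *)
Record smoothManifold (R : realType) (n : nat) := SmoothManifold {
  mcarrier :> topologicalType;
  cdom : mcarrier -> set mcarrier;
  chart : mcarrier -> mcarrier -> 'rV[R]_n;
  unchart : mcarrier -> 'rV[R]_n -> mcarrier;
  manifold_hausdorff : hausdorff_space mcarrier;
  manifold_second_countable : @second_countable mcarrier;
  cdom_open : forall p, open (cdom p);
  cdom_center : forall p, cdom p p;
  cimg_open : forall p, open (chart p @` cdom p);
  chartK : forall p q, cdom p q -> unchart p (chart p q) = q;
  chart_continuous : forall p, {within cdom p, continuous (chart p)};
  unchart_continuous :
    forall p, {within chart p @` cdom p, continuous (unchart p)};
  transition_smooth : forall p q (i : 'I_n),
    smooth_on (chart p @` (cdom p `&` cdom q))
              (fun x => chart q (unchart p x) ord0 i)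
}.

Section Manifold.
Variables (R : realType) (n : nat) (M : smoothManifold R n).

Definition smooth_fun (U : set M) (f : M -> R) : Prop :=
  forall p : M, smooth_on (chart p @` (cdom p `&` U)) (f \o unchart p).

(* The tangent space T_qM is R^n, read in the chart centred at q.
   [coordvec p q v] is the value at q, as an element of T_qM, of the coordinate
   vector field of the chart at p in the direction v. *)
Definition coordvec (p q : M) (v : 'rV[R]_n) : 'rV[R]_n :=
  'D_v (fun x => chart q (unchart p x)) (chart p q).

(* Forms of mixed degree.  The value of eta at p is a function of lists of tangent vectors; the component
   of degree k is its restriction to the lists of length k. *)
Definition pform (W : M -> lmodType R) : Type :=
  forall p : M, seq 'rV[R]_n -> W p.

Section PformLmod.
Variable W : M -> lmodType R.
Implicit Types a b c : pform W.

HB.instance Definition _ := gen_eqMixin (pform W).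
HB.instance Definition _ := gen_choiceMixin (pform W).

Definition pform_zero : pform W := fun _ _ => 0.
Definition pform_opp a : pform W := fun p vs => - a p vs.
Definition pform_add a b : pform W := fun p vs => a p vs + b p vs.
Definition pform_scale (r : R) a : pform W := fun p vs => r *: a p vs.

Lemma pformP a b : (forall p vs, a p vs = b p vs) -> a = b.
Proof.
by move=> e; apply: functional_extensionality_dep => p; apply/funext => vs.
Qed.

Lemma pform_addA : associative pform_add.
Proof. by move=> a b c; apply: pformP => p vs; apply: addrA. Qed.
Lemma pform_addC : commutative pform_add.
Proof. by move=> a b; apply: pformP => p vs; apply: addrC. Qed.
Lemma pform_add0 : left_id pform_zero pform_add.
Proof. by move=> a; apply: pformP => p vs; apply: add0r. Qed.
Lemma pform_addN : left_inverse pform_zero pform_opp pform_add.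
Proof. by move=> a; apply: pformP => p vs; apply: addNr. Qed.

HB.instance Definition _ := GRing.isZmodule.Build (pform W)
  pform_addA pform_addC pform_add0 pform_addN.

Lemma pform_scaleA r s a :
  pform_scale r (pform_scale s a) = pform_scale (r * s) a.
Proof. by apply: pformP => p vs; apply: scalerA. Qed.
Lemma pform_scale1 : left_id 1 pform_scale.
Proof. by move=> a; apply: pformP => p vs; apply: scale1r. Qed.
Lemma pform_scaleDr : right_distributive pform_scale +%R.
Proof. by move=> r a b; apply: pformP => p vs; apply: scalerDr. Qed.
Lemma pform_scaleDl a : {morph pform_scale^~ a : r s / r + s}.
Proof. by move=> r s; apply: pformP => p vs; apply: scalerDl. Qed.

HB.instance Definition _ := GRing.Zmodule_isLmodule.Build R (pform W)
  pform_scaleA pform_scale1 pform_scaleDr pform_scaleDl.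

End PformLmod.

Definition multilinear (W : lmodType R) (f : seq 'rV[R]_n -> W) : Prop :=
  forall (s t : seq 'rV[R]_n) (a : R) (u v : 'rV[R]_n),
    f (s ++ (a *: u + v) :: t) = a *: f (s ++ u :: t) + f (s ++ v :: t).

Definition alternating (W : lmodType R) (f : seq 'rV[R]_n -> W) : Prop :=
  forall (s t r : seq 'rV[R]_n) (u : 'rV[R]_n),
    f (s ++ u :: t ++ u :: r) = 0.

(* The smooth W-valued forms, where [ss U s] says that s is a smooth section
   of W over the open set U. *)
Definition smooth_forms (W : M -> lmodType R)
    (ss : set M -> (forall p, W p) -> Prop) : set (pform W) :=
  [set eta | (forall p, multilinear (eta p) /\ alternating (eta p)) /\
    forall (p : M) (vs : seq 'rV[R]_n),
      ss (cdom p) (fun q => eta q (map (coordvec p q) vs))].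

Definition has_degree (W : M -> lmodType R) (k : nat) (eta : pform W) : Prop :=
  forall p vs, size vs != k -> eta p vs = 0.

Definition sform : Type := pform (fun _ : M => R^o).

Definition Omega_scalar : set sform :=
  smooth_forms (W := fun _ : M => R^o) smooth_fun.

(* The sign of the shuffle that moves the positions selected by m in front of
   the others is (-1)^(mask_inv m). *)
Fixpoint mask_inv (m : bitseq) : nat :=
  if m is b :: m' then ((if b then 0 else count id m') + mask_inv m')%N else 0%N.

(* (a /\ e)(v_1, ..., v_m) is the signed sum over all shuffles, without
   factorials. *)
Definition wedge (W : M -> lmodType R) (alpha : sform) (eta : pform W) :
    pform W := fun p vs =>
  \sum_(m : (size vs).-tuple bool)
    (-1) ^+ mask_inv m *:
      ((alpha p (mask m vs) : R) *: eta p (mask (map negb m) vs)).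

(* At p, computed in the chart centred at p:
   (d a)(v_0, ..., v_k) = \sum_j (-1)^j d_{v_j} a(v_0, .., omit v_j, .., v_k). *)
Definition ext_d (alpha : sform) : sform := fun p vs =>
  \sum_(j < size vs) (-1) ^+ j *
    ('D_(nth 0 vs j)
       (fun x : 'rV[R]_n =>
          (alpha (unchart p x)
             (map (coordvec p (unchart p x)) (take j vs ++ drop j.+1 vs)) : R))
       (chart p p)).

Record symplectic (omega : sform) : Prop := Symplectic {
  symplectic_smooth : Omega_scalar omega;
  symplectic_degree : has_degree 2 omega;
  symplectic_closed : ext_d omega = 0;
  symplectic_nondegenerate : forall (p : M) (u : 'rV[R]_n),
    (forall v, omega p [:: u; v] = 0) -> u = 0
}.

(* A family of finite-dimensional vector spaces with smoothly compatible local
   frames; [frame p] is a frame over the neighbourhood [fdom p] of p (with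
   irrelevant values outside [fdom p]). *)
Record vbundle := VBundle {
  fiber :> M -> vectType R;
  fdom : M -> set M;
  frank : M -> nat;
  frame : forall p q : M, (frank p).-tuple (fiber q);
  fdom_open : forall p, open (fdom p);
  fdom_center : forall p, fdom p p;
  frame_basis : forall p q, fdom p q -> basis_of fullv (frame p q);
  frame_smooth : forall p p' (a : 'I_(frank p)) (b : 'I_(frank p')),
    smooth_fun (fdom p `&` fdom p')
               (fun q => coord (frame p q) a (tnth (frame p' q) b))
}.

Definition smooth_section (E : vbundle) (U : set M) (s : forall p, E p) :
    Prop :=
  forall (p : M) (a : 'I_(frank E p)),
    smooth_fun (U `&` fdom E p) (fun q => coord (frame E p q) a (s q)).

Record superbundle := SuperBundle { even_bundle : vbundle; odd_bundle : vbundle }.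

Section Super.
Variable E : superbundle.

Definition sfiber (p : M) : vectType R :=
  (even_bundle E p * odd_bundle E p)%type.

Definition smooth_ssection (U : set M) (s : forall p, sfiber p) : Prop :=
  smooth_section (E := even_bundle E) U (fun q => (s q).1) /\
  smooth_section (E := odd_bundle E) U (fun q => (s q).2).

(* A section of End(E) is smooth when its columns in the local frames are. *)
Definition smooth_esection (U : set M) (L : forall p, 'End(sfiber p)) : Prop :=
  (forall (p : M) (a : 'I_(frank (even_bundle E) p)),
     smooth_ssection (U `&` fdom (even_bundle E) p)
       (fun q => L q (tnth (frame (even_bundle E) p q) a, 0))) /\
  (forall (p : M) (a : 'I_(frank (odd_bundle E) p)),
     smooth_ssection (U `&` fdom (odd_bundle E) p)
       (fun q => L q (0, tnth (frame (odd_bundle E) p q) a))).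

Definition eform : Type := pform (fun p => sfiber p : lmodType R).
Definition endform : Type := pform (fun p => 'End(sfiber p) : lmodType R).

Definition Omega : set eform :=
  smooth_forms (W := fun p => sfiber p : lmodType R) smooth_ssection.
Definition OmegaEnd : set endform :=
  smooth_forms (W := fun p => 'End(sfiber p) : lmodType R) smooth_esection.

(* Z_2-degrees are booleans: false is even, true is odd; they add by (+). *)
Definition vpart (b : bool) (p : M) (w : sfiber p) : sfiber p :=
  if b then (0, w.2) else (w.1, 0).

Definition vproj (b : bool) (p : M) : 'End(sfiber p) := linfun (@vpart b p).

(* Component of L mapping each E^b to E^(b + c). *)
Definition epart (c : bool) (p : M) (L : 'End(sfiber p)) : 'End(sfiber p) :=
  \sum_(b : bool) (vproj (b (+) c) p \o L \o vproj b p)%VF.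

Definition tpart (b : bool) (eta : eform) : eform := fun p vs =>
  vpart (b (+) odd (size vs)) (eta p vs).
Definition etpart (b : bool) (F : endform) : endform := fun p vs =>
  epart (b (+) odd (size vs)) (F p vs).

Definition Omega_ (b : bool) : set eform :=
  [set eta | Omega eta /\ tpart b eta = eta].
Definition OmegaEnd_ (b : bool) : set endform :=
  [set F | OmegaEnd F /\ etpart b F = F].

(* The action (a (x) L)(b (x) v) = (-1)^(|L||b|) (a /\ b) (x) L(v). *)
Definition act (F : endform) (eta : eform) : eform := fun p vs =>
  \sum_(m : (size vs).-tuple bool)
    let vs1 := mask m vs in let vs2 := mask (map negb m) vs in
    (-1) ^+ mask_inv m *:
      \sum_(c : bool) (-1) ^+ (c * size vs2) *: epart c (F p vs1) (eta p vs2).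

Definition fmul (f : M -> R) (eta : eform) : eform := fun p vs =>
  f p *: eta p vs.

(* [A] is only relevant on [Omega].  First-order differential operators are
   those whose iterated commutators with two smooth functions vanish. *)
Record superconnection (A : eform -> eform) : Prop := Superconnection {
  sc_stable : forall eta, Omega eta -> Omega (A eta);
  sc_linear : forall (r : R) eta zeta, Omega eta -> Omega zeta ->
    A (r *: eta + zeta) = r *: A eta + A zeta;
  sc_first_order : forall (f g : M -> R) eta,
    smooth_fun setT f -> smooth_fun setT g -> Omega eta ->
    A (fmul f (fmul g eta)) - fmul f (A (fmul g eta))
      - (fmul g (A (fmul f eta)) - fmul g (fmul f (A eta))) = 0;
  sc_odd : forall b eta, Omega_ b eta -> Omega_ (~~ b) (A eta);
  sc_leibniz : forall k (alpha : sform) eta,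
    Omega_scalar alpha -> has_degree k alpha -> Omega eta ->
    A (wedge alpha eta) = wedge (ext_d alpha) eta
                          + (-1) ^+ k *: wedge alpha (A eta)
}.

Record primitive_superconnection (omega : sform) := PrimitiveSuperconnection {
  ps_conn : eform -> eform;
  ps_end : endform;
  ps_connP : superconnection ps_conn;
  ps_endP : OmegaEnd_ false ps_end
}.

Section Primitive.
Variables (omega : sform) (AA : primitive_superconnection omega).
Let A := ps_conn AA.
Let B := ps_end AA.

Definition ps_map (x : eform * eform) : eform * eform :=
  (A x.1 + wedge omega x.2, act B x.1 - A x.2).

(* The supercommutator [A, F], extended linearly, as an operator. *)
Definition scomm (F : endform) (eta : eform) : eform :=
  \sum_(b : bool)
    (A (act (etpart b F) eta) - (-1) ^+ b *: act (etpart b F) (A eta)).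

Definition pbracket1 (F G : endform) (eta : eform) : eform :=
  scomm F eta + act (wedge omega G) eta.
Definition pbracket2 (F G : endform) (eta : eform) : eform :=
  act B (act F eta) - act F (act B eta) - scomm G eta.

End Primitive.

(* The block of D from forms of parity c to forms of parity b: D_1, D_2, D_3,
   D_4 are the blocks (b, c) = (+,+), (+,-), (-,+), (-,-). *)
Definition block (D : eform -> eform) (b c : bool) (eta : eform) : eform :=
  tpart b (D (tpart c eta)).

Definition tensorial (D : eform -> eform) : Prop :=
  forall k (beta : sform) eta,
    Omega_scalar beta -> has_degree k beta -> Omega eta ->
    D (wedge beta eta) = \sum_(b : bool) \sum_(c : bool)
      (-1) ^+ (k * (b (+) c)) *: wedge beta (block D b c eta).

(* The operator D on Omega(M, E) is identified with F. *)
Definition op_identified (D : eform -> eform) (F : endform) : Prop :=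
  [/\ OmegaEnd F, tensorial D & forall eta, Omega eta -> D eta = act F eta].

(* The operator DD on Omega(M, E) (+) Omega(M, E) is identified with (F, G). *)
Definition pair_identified (DD : eform * eform -> eform * eform)
    (F G : endform) : Prop :=
  exists D Dt : eform -> eform,
    [/\ op_identified D F, op_identified Dt G &
     forall alpha beta, Omega alpha -> Omega beta ->
       DD (alpha, beta) =
         (D alpha,
          Dt alpha + \sum_(b : bool) \sum_(c : bool)
                       (-1) ^+ (b (+) c) *: block D b c beta)].

(* [[AA, (F, G)]] = (H, K) in Omega(M, End E) (+) Omega(M, End E). *)
Definition pbracket_is (omega : sform) (AA : primitive_superconnection omega)
    (F G H K : endform) : Prop :=
  op_identified (pbracket1 AA F G) H /\ op_identified (pbracket2 AA F G) K.

End Super.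
End Manifold.

(* Main.v *)
Require Import Defs.
From HB Require Import structures.
From mathcomp Require Import all_boot all_order all_algebra.
From mathcomp Require Import all_classical all_reals all_analysis.
From mathcomp Require Import zify ring.
Set Implicit Arguments.
Unset Strict Implicit.
Unset Printing Implicit Defensive.
Import Order.TTheory GRing.Theory Num.Theory.
Import numFieldNormedType.Exports.
Local Open Scope classical_set_scope.
Local Open Scope ring_scope.

(** The primitive superconnection sends a pair (a, b) of forms to
    (A a + omega b, B a - A b).  Its square is (a, b) |-> (X a, Y a + X b), where
    X = A^2 + omega B and Y = BA - AB: the off-diagonal term A omega - omega A
    vanishes because omega is closed and even ([ps_map2]).  Hence the 2k-th power
    is (a, b) |-> (F a, G a + F b) for an even operator F and an odd operator G
    built from X and Y by sums and compositions ([iter_ps_map]).  The bracket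
    vanishes because a power of a map commutes with that map: the components of
    this identity at (a, 0) are AF + omega G = FA and BF - AG = GA + FB, which
    say that the two components of the bracket vanish.

    What remains is that F and G are the actions of unique smooth forms with
    values in the endomorphisms.  The operators in
    question commute with multiplication by functions, and commute up to the sign
    of their parity with exterior multiplication by differentials of functions
    ([graded_linear]).  For A^2 this is d(df) = 0, that is, the symmetry of second
    derivatives ([derive_swap], [ddfun]); the property passes to X, Y, sums and
    compositions.  It implies that the operator is of the form [act]
    ([symbol_act]):
    - bump functions ([exists_bump]) make the operator local, so that on sections
      it is determined by its values on a local frame, and these values form the
      endomorphism-valued form [symbol];
    - the difference with the action of [symbol] kills all sections.  By the Euler
      identity (k+1) eta = \sum_i dx^i /\ (iota_i eta) for eta of degree k+1
      ([euler_identity]), it kills forms of every degree, by induction on the degree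
      ([glin_vanish]).
    Sections through a given vector give uniqueness ([act_inj]).

    Products of forms are sums over shuffles.  They are handled through a recursion
    on the list of vectors ([shuffle]), for which associativity, graded
    commutativity, and the preservation of multilinearity and of alternation are
    inductions on that list. *)

(** * Smooth functions on open sets of a coordinate space *)

Section SmoothCalculus.
Context {R : realType}.

(** Both derivatives have the same first-order expansion at [x], since the
    expansion only involves values near [x]. *)
Lemma near_eq_differentiable (V W : normedModType R) (f g : V -> W) (x : V) :
  (\near x, f x = g x) -> differentiable f x -> differentiable g x.
Proof.
move=> fg df.
have E : g \o shift x = cst (g x) + 'd f x +o_ (0 : V) id.
  apply/eqaddoP => e e0.
  have /eqaddoP /(_ e e0) := diff_locally df.
  have fg0 : \forall y \near (0 : V), f (y + x) = g (y + x).
    by move: fg; rewrite (near_shift 0 x) subr0.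
  apply: filterS2 (fg0) => y /= E1.
  rewrite !fctE /= => H; rewrite -(nbhs_singleton fg) -E1; exact: H.
apply/diff_locallyP; have D : 'd g x = 'd f x :> (V -> W).
  by apply: diff_unique E; exact: diff_continuous.
by rewrite D; split=> //; exact: diff_continuous.
Qed.

Lemma iter_derive_rcons (m : nat) (vs : seq 'rV[R]_m) v f :
  iter_derive (rcons vs v) f = iter_derive vs ('D_v f).
Proof. by rewrite /iter_derive foldr_rcons. Qed.

(** [smooth_on] truncated at order [N]: closure properties are proved by
    induction on [N], since differentiating a product or a composite produces
    functions that are only known to satisfy the property at lower order. *)
Definition Ck (m : nat) N (O : set 'rV[R]_m) (f : 'rV[R]_m -> R) : Prop :=
  forall vs x, (size vs <= N)%N -> O x -> differentiable (iter_derive vs f) x.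

Lemma CkP m (O : set 'rV[R]_m) f : smooth_on O f <-> forall N, Ck N O f.
Proof.
split=> [sf N vs x _ Ox|sf vs x Ox]; first exact: sf.
exact: (sf (size vs)).
Qed.

Lemma Ck0 m N (O : set 'rV[R]_m) f x : Ck N O f -> O x -> differentiable f x.
Proof. by move=> sf Ox; exact: (sf [::]). Qed.

(** The list of directions is consumed from its end: the last one is the first
    to be differentiated. *)
Lemma CkS m N (O : set 'rV[R]_m) f :
  Ck N.+1 O f <-> (forall x, O x -> differentiable f x) /\ forall v, Ck N O ('D_v f).
Proof.
split=> [sf|[df sf] vs x].
  split=> [x Ox|v vs x svs Ox]; first exact: (sf [::]).
  by rewrite -iter_derive_rcons; apply: sf; rewrite ?size_rcons.
(* The last direction of the list is differentiated first. *)
case/lastP: vs => [|vs v] svs Ox; first exact: df.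
rewrite iter_derive_rcons; apply: sf => //.
by rewrite size_rcons in svs.
Qed.

Lemma CkW m N (O : set 'rV[R]_m) f : Ck N.+1 O f -> Ck N O f.
Proof. by move=> sf vs x svs Ox; apply: sf => //; exact: leqW. Qed.

Lemma derive_eq_on (V W : normedModType R) (O : set V) (f g : V -> W) v x :
  open O -> (forall x, O x -> f x = g x) -> O x -> 'D_v f x = 'D_v g x.
Proof.
move=> oO fg Ox; apply: near_eq_derive.
by apply: filterS (open_nbhs_nbhs (conj oO Ox)).
Qed.

Lemma differentiable_eq_on (V W : normedModType R) (O : set V) (f g : V -> W) x :
  open O -> (forall x, O x -> f x = g x) -> O x -> differentiable f x -> differentiable g x.
Proof.
move=> oO fg Ox; apply: near_eq_differentiable.
by apply: filterS (open_nbhs_nbhs (conj oO Ox)).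
Qed.

Lemma iter_derive_eq_on m (O : set 'rV[R]_m) f g vs x :
  open O -> (forall x, O x -> f x = g x) -> O x -> iter_derive vs f x = iter_derive vs g x.
Proof.
move=> oO fg; elim: vs x => [|v vs IH] x Ox; first exact: fg.
exact: (derive_eq_on _ oO).
Qed.

Lemma Ck_eq m N (O : set 'rV[R]_m) f g :
  open O -> (forall x, O x -> f x = g x) -> Ck N O f -> Ck N O g.
Proof.
move=> oO fg sf vs x svs Ox.
apply: (differentiable_eq_on oO) (sf vs x svs Ox) => // y.
exact: iter_derive_eq_on.
Qed.

Lemma Ck_cst m N (O : set 'rV[R]_m) c : open O -> Ck N O (fun=> c).
Proof.
move=> oO; elim: N c => [|N IH] c.
  by move=> [|//] x _ Ox; exact: differentiable_cst.
apply/CkS; split=> [x Ox|v]; first exact: differentiable_cst.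
by apply: (Ck_eq oO _ (IH 0)) => // x xO; rewrite derive_cst.
Qed.

Lemma CkD m N (O : set 'rV[R]_m) f g :
  open O -> Ck N O f -> Ck N O g -> Ck N O (fun x => f x + g x).
Proof.
move=> oO; elim: N f g => [|N IH] f g.
  move=> sf sg [|//] x _ Ox.
  by apply: differentiableD; [exact: (Ck0 sf)|exact: (Ck0 sg)].
move=> /CkS[df sf] /CkS[dg sg]; apply/CkS; split=> [x Ox|v].
  by apply: differentiableD; [exact: df|exact: dg].
apply: (Ck_eq oO _ (IH _ _ (sf v) (sg v))) => // x Ox.
by rewrite deriveD //; apply: diff_derivable; [exact: df|exact: dg].
Qed.

Lemma CkM m N (O : set 'rV[R]_m) f g :
  open O -> Ck N O f -> Ck N O g -> Ck N O (fun x => f x * g x).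
Proof.
move=> oO; elim: N f g => [|N IH] f g.
  move=> sf sg [|//] x _ Ox.
  by apply: differentiableM; [exact: (Ck0 sf)|exact: (Ck0 sg)].
move=> cf cg; have /CkS[df sf] := cf; have /CkS[dg sg] := cg.
apply/CkS; split=> [x Ox|v].
  by apply: differentiableM; [exact: df|exact: dg].
apply: (Ck_eq oO _ (CkD oO (IH _ _ (CkW cf) (sg v)) (IH _ _ (CkW cg) (sf v)))) => // x Ox.
by rewrite deriveM //; apply: diff_derivable; [exact: df|exact: dg].
Qed.

Lemma Ck_sum m N (O : set 'rV[R]_m) (I : Type) (r : seq I) (P : pred I)
    (f : I -> 'rV[R]_m -> R) :
  open O -> (forall i, Ck N O (f i)) -> Ck N O (fun x => \sum_(i <- r | P i) f i x).
Proof.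
move=> oO sf; elim: r => [|i r IH].
  by apply: (Ck_eq oO _ (Ck_cst 0 oO)) => // x _; rewrite big_nil.
case Pi: (P i).
  by apply: (Ck_eq oO _ (CkD oO (sf i) IH)) => // x _; rewrite big_cons Pi.
by apply: (Ck_eq oO _ IH) => // x _; rewrite big_cons Pi.
Qed.

Lemma differentiable_rV (V : normedModType R) m (f : V -> 'rV[R]_m) x :
  (forall i, differentiable (fun y => f y 0 i : R) x) -> differentiable f x.
Proof.
move=> df.
have -> : f = \sum_(i < m) (fun y => (f y 0 i : R) *: (delta_mx 0 i : 'rV[R]_m)).
  apply/funext => y; rewrite fct_sumE.
  by apply/rowP => j; rewrite [f y in LHS]row_sum_delta.
by apply: differentiable_sum => i; exact: differentiableZl.
Qed.

Lemma derive_rV (V : normedModType R) m (f : V -> 'rV[R]_m) x v i :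
  differentiable f x -> 'D_v f x 0 i = 'D_v (fun y => f y 0 i) x.
Proof. by move=> df; rewrite derive_mx ?mxE //; exact: diff_derivable. Qed.

Lemma derive_chain (U V W : normedModType R) (f : V -> W) (g : U -> V) x v :
  differentiable g x -> differentiable f (g x) ->
  'D_v (f \o g) x = 'D_('D_v g x) f (g x).
Proof.
move=> dg df; rewrite deriveE; last exact: differentiable_comp.
by rewrite diff_comp //= -deriveE // -deriveE.
Qed.

Lemma derive_sum_dir m (f : 'rV[R]_m -> R) x v :
  differentiable f x ->
  'D_v f x = \sum_(i < m) v 0 i * 'D_(delta_mx 0 i) f x.
Proof.
move=> df; rewrite deriveE // {1}[v]row_sum_delta linear_sum.
by apply: eq_bigr => i _; rewrite linearZ deriveE.
Qed.

Lemma deriveDr (V W : normedModType R) (f : V -> W) x u v a :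
  differentiable f x -> 'D_(a *: u + v) f x = a *: 'D_u f x + 'D_v f x.
Proof. by move=> df; rewrite !deriveE // linearP. Qed.

(** By the chain rule a directional derivative of a composite is a sum of products
    of composites of one order less with derivatives of the components. *)
Lemma Ck_comp m k N (O : set 'rV[R]_m) (Q : set 'rV[R]_k)
    (f : 'rV[R]_k -> R) (g : 'rV[R]_m -> 'rV[R]_k) :
  open O -> open Q -> (forall x, O x -> Q (g x)) -> Ck N Q f ->
  (forall i, Ck N O (fun x => g x 0 i)) -> Ck N O (f \o g).
Proof.
move=> oO oQ OQ; elim: N f => [|N IH] f cf cg.
  move=> [|//] x _ Ox; apply: differentiable_comp.
    by apply: differentiable_rV => i; exact: (Ck0 (cg i)).
  by apply: (Ck0 cf); exact: OQ.
have dg x : O x -> differentiable g x.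
  by move=> Ox; apply: differentiable_rV => i; exact: (Ck0 (cg i)).
have /CkS[df sf] := cf; apply/CkS; split=> [x Ox|v].
  by apply: differentiable_comp; [exact: dg|exact: df (OQ _ Ox)].
pose h x := \sum_(i < k) 'D_v (fun x => g x 0 i) x * ('D_(delta_mx 0 i) f \o g) x.
have ch : Ck N O h.
  apply: Ck_sum => // i; apply: CkM => //.
    by have /CkS[_] := cg i; exact.
  by apply: IH => // j; exact: CkW.
apply: (Ck_eq oO _ ch) => // x Ox.
rewrite derive_chain; [|exact: dg|exact: df (OQ _ Ox)].
rewrite derive_sum_dir; last exact: df (OQ _ Ox).
by apply: eq_bigr => i _; rewrite derive_rV //; exact: dg.
Qed.

End SmoothCalculus.

(** * Symmetry of second derivatives; functions flat at the origin *)

Section Schwarz.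
Context {R : realType}.

Lemma is_derive_line (V : normedModType R) (f : V -> R) (c v : V) (s : R) :
  differentiable f (c + s *: v) ->
  is_derive s 1 (fun t : R => f (c + t *: v)) ('D_v f (c + s *: v)).
Proof.
move=> df; have E : (fun t : R => c + t *: v) = cst c + (fun t => t *: v) by [].
have dl : is_diff s (fun t : R => c + t *: v) (0 + ( *:%R^~ v)).
  rewrite E; apply: is_diffD; exact: is_diff_scalel.
have dl' := @ex_diff _ _ _ _ _ _ _ dl.
have E2 : 'D_1 (fun t : R => c + t *: v) s = v.
  by rewrite deriveE // diff_val /= !fctE add0r scale1r.
apply: DeriveDef.
  apply: diff_derivable; exact: (@differentiable_comp _ _ _ _ (fun t : R => c + t *: v) f).
by rewrite (derive_chain (f := f) (g := fun t : R => c + t *: v)) //= E2.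
Qed.

(** The mean value theorem applied first in the direction [v], then in [w].  The
    left-hand side is symmetric in [v] and [w], which is what gives the symmetry of
    second derivatives. *)
Lemma second_difference (V : normedModType R) (O : set V) (f : V -> R) (x v w : V) :
  (forall y, O y -> differentiable f y) ->
  (forall y, O y -> differentiable ('D_v f) y) ->
  forall h : R, 0 < h ->
  (forall s t : R, 0 <= s <= h -> 0 <= t <= h -> O (x + s *: v + t *: w)) ->
  exists s t : R, [/\ 0 <= s <= h, 0 <= t <= h &
    f (x + h *: v + h *: w) - f (x + h *: v) - (f (x + h *: w) - f x) =
    'D_w ('D_v f) (x + s *: v + t *: w) * h * h].
Proof.
move=> df d2f h h0 Oh.
have hh : 0 <= h <= h by rewrite lexx ltW.
have h00 : (0 : R) <= 0 <= h by rewrite lexx ltW.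
pose phi s := f (x + h *: w + s *: v) - f (x + s *: v).
pose dphi s := 'D_v f (x + h *: w + s *: v) - 'D_v f (x + s *: v).
have dp s : s \in `[0, h] -> is_derive s 1 phi (dphi s).
  rewrite in_itv /= => sh; apply: is_deriveB; apply: is_derive_line; apply: df.
    by rewrite addrAC; exact: Oh.
  by rewrite -[_ + _]addr0 -(scale0r w); exact: Oh.
have [s sh E] := MVT h0 (fun s sh => dp s (subset_itv_oo_cc sh))
  (derivable_within_continuous (fun s sh => @ex_derive _ _ _ _ _ _ _ (dp s sh))).
have sh' : 0 <= s <= h by move: sh; rewrite in_itv /= => /andP[/ltW -> /ltW ->].
pose psi t := 'D_v f (x + s *: v + t *: w).
have dq t : t \in `[0, h] -> is_derive t 1 psi ('D_w ('D_v f) (x + s *: v + t *: w)).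
  by rewrite in_itv /= => th; apply: is_derive_line; apply: d2f; exact: Oh.
have [t th E2] := MVT h0 (fun s sh => dq s (subset_itv_oo_cc sh))
  (derivable_within_continuous (fun s sh => @ex_derive _ _ _ _ _ _ _ (dq s sh))).
exists s, t; split => //.
  by move: th; rewrite in_itv /= => /andP[/ltW -> /ltW ->].
transitivity (phi h - phi 0).
  by rewrite /phi !scale0r !addr0 [x + h *: w + _]addrAC.
rewrite E subr0; congr (_ * _).
by rewrite /dphi [x + h *: w + _]addrAC; move: E2; rewrite /psi scale0r addr0 subr0.
Qed.

(** Both mixed derivatives at [x] are limits of their values at intermediate points
    of one and the same second difference. *)
Lemma derive_swap (V : normedModType R) (O : set V) (f : V -> R) (x v w : V) :
  open O -> O x ->
  (forall y, O y -> differentiable f y) ->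
  (forall u y, O y -> differentiable ('D_u f) y) ->
  (forall u u' y, O y -> differentiable ('D_u ('D_u' f)) y) ->
  'D_v ('D_w f) x = 'D_w ('D_v f) x.
Proof.
move=> oO Ox df d2f d3f; apply/eqP; rewrite -subr_eq0 -normr_eq0.
apply/eqP/le_anti; rewrite normr_ge0 andbT; apply/ler_addgt0Pr => e e0; rewrite add0r.
pose N := [set y | O y /\ `|'D_v ('D_w f) y - 'D_v ('D_w f) x| < e / 2 /\
           `|'D_w ('D_v f) y - 'D_w ('D_v f) x| < e / 2].
have : nbhs x N.
  have e2 : 0 < e / 2 by rewrite divr_gt0.
  have C u u' : \forall y \near x, `|'D_u ('D_u' f) y - 'D_u ('D_u' f) x| < e / 2.
    have /cvgrPdist_lt /(_ _ e2) := differentiable_continuous (d3f u u' x Ox).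
    by move=> H; apply: filterS H => y H; rewrite [X in X < _]distrC; exact: H.
  by apply: filterI; [exact: open_nbhs_nbhs|apply: filterI; [exact: (C v w)|exact: (C w v)]].
move=> /nbhs_ballP[r /= r0 rN].
(* The summand 1 avoids a division by zero when [v] and [w] vanish. *)
pose h := r / (`|v| + `|w| + 1).
have d0 : 0 < `|v| + `|w| + 1 by rewrite ltr_wpDl ?addr_ge0.
have h0 : 0 < h by rewrite divr_gt0.
have Nh u u' : `|u| + `|u'| <= `|v| + `|w| ->
    forall s t : R, 0 <= s <= h -> 0 <= t <= h -> N (x + s *: u + t *: u').
  move=> uu s t /andP[s0 sh] /andP[t0 th]; apply: rN; rewrite -ball_normE /=.
  rewrite -addrA opprD addrA subrr add0r normrN.
  apply: le_lt_trans (ler_normD _ _) _; rewrite !normrZ !ger0_norm //.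
  apply: (@le_lt_trans _ _ (h * (`|u| + `|u'|))).
    by rewrite mulrDr lerD // ler_wpM2r.
  apply: (@le_lt_trans _ _ (h * (`|v| + `|w|))); first by rewrite ler_wpM2l // ltW.
  by rewrite /h mulrAC ltr_pdivrMr // ltr_pM2l // ltrDl.
have [s [t [sh th E]]] := second_difference df (d2f v) h0
  (fun s t sh th => proj1 (Nh v w (lexx _) s t sh th)).
have wv : `|w| + `|v| <= `|v| + `|w| by rewrite addrC.
have [s' [t' [sh' th' E']]] := second_difference df (d2f w) h0
  (fun s t sh th => proj1 (Nh w v wv s t sh th)).
have [_ [_ N1]] := Nh _ _ (lexx _) _ _ sh th.
have [_ [N2 _]] := Nh _ _ wv _ _ sh' th'.
have EE : 'D_w ('D_v f) (x + s *: v + t *: w) = 'D_v ('D_w f) (x + s' *: w + t' *: v).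
  have hN0 : h * h != 0 by rewrite mulf_neq0 // gt_eqF.
  apply: (mulIf hN0); rewrite [LHS]mulrA [RHS]mulrA -E -E' [x + h *: w + _]addrAC.
  move: (f (x + h *: v + h *: w)) (f (x + h *: v)) (f (x + h *: w)) (f x) => a b c d'.
  by rewrite !opprB !addrA addrAC [in RHS]addrAC; congr (_ + _); rewrite addrAC.
rewrite EE in N1; rewrite [e]splitr.
apply: ltW; apply: le_lt_trans (ltrD N1 N2).
move: ('D_v ('D_w f) x) ('D_w ('D_v f) x) ('D_v ('D_w f) (x + s' *: w + t' *: v)) => a b c.
by rewrite [leRHS]addrC (distrC c a); exact: ler_distD.
Qed.
End Schwarz.

Section Flat.
Context {R : realType}.
Implicit Types (P Q : {poly R}).

(** The functions P(1/t) exp(-1/t) extended by 0: a family closed under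
    differentiation, all of whose members vanish for t <= 0.  It gives smoothness of
    exp(-1/t) with no formula for its higher derivatives. *)
Definition flat P (t : R) : R := if 0 < t then P.[t^-1] * expR (- t^-1) else 0.

Definition flat_deriv P : {poly R} := 'X^2 * (P - P^`()).

(** Termwise, from y^i / i! <= exp y. *)
Lemma poly_expR_bounded P : exists2 C : R, 0 < C &
  forall y, 0 < y -> `|P.[y]| * expR (- y) <= C.
Proof.
exists (1 + \sum_(i < size P) `|P`_i| * (i`!)%:R).
  by rewrite ltr_pwDl // sumr_ge0 // => i _; rewrite mulr_ge0.
move=> y y0; rewrite expRN ler_pdivrMr ?expR_gt0 // horner_coef.
apply: le_trans (ler_norm_sum _ _ _) _; rewrite mulrDl mul1r.
apply: (@le_trans _ _ (\sum_(i < size P) `|P`_i| * i`!%:R * expR y)); last first.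
  by rewrite mulr_suml lerDr expR_ge0.
apply: ler_sum => i _; rewrite normrM -mulrA ler_wpM2l // normrX gtr0_norm //.
case: (nat_of_ord i) => [|j].
  by rewrite expr0 fact0 mul1r -expR0 ler_expR ltW.
rewrite mulrC -ler_pdivrMr ?ltr0n ?fact_gt0 //.
by apply: le_trans (expR_ge1Dxn j (ltW y0)); rewrite lerDr.
Qed.

(** At 0 the bound on y^2 P(y) exp(-y) for y = 1/h gives |flat P h| <= C h^2. *)
Lemma is_derive_flat P (t : R) : is_derive t 1 (flat P) (flat (flat_deriv P) t).
Proof.
case: (ltgtP t 0) => [t0|t0|->].
- rewrite /flat.
  rewrite ltNge (ltW t0) /=.
  apply: (near_eq_is_derive (f := cst 0)).
  near=> s; rewrite ifF //; apply/negbTE; rewrite -leNgt ltW //.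
  by near: s; exact: lt_nbhsl.
- rewrite /flat t0.
  apply: (near_eq_is_derive (f := (horner P \o (fun s => s^-1)) * (expR \o (fun s : R => - s^-1)))).
    by apply: filterS (lt_nbhsr t0) => s s0; rewrite s0.
  have tN0 : t != 0 by rewrite gt_eqF.
  have di : is_derive t 1 (fun s : R => s^-1) (- t ^- 2).
    have := @is_deriveV R id t 1 1 tN0 (is_derive_id _ _).
    by rewrite /GRing.scale /= mulr1.
  have dp := is_derive1_comp (is_derive_poly P t^-1) di.
  have dn : is_derive t 1 (fun s : R => - s^-1) (- - t ^- 2) by exact: is_deriveN di.
  have de := @is_derive1_comp R expR (fun s : R => - s^-1) t _ _ (is_derive_expR (- t^-1)) dn.
  apply: is_derive_eq (is_deriveM dp de) _.
  rewrite /flat_deriv !hornerE /GRing.scale /= opprK exprVn; ring.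
- rewrite [flat (flat_deriv P) 0]/flat ltxx.
  (* The factor y^2 compensates the quotient by h = 1/y and leaves one factor h. *)
  have [C C0 HC] := poly_expR_bounded ('X^2 * P).
  have L : (fun h : R => h^-1 *: (flat P (h *: 1 + 0) - flat P 0)) @ 0^' --> (0 : R).
    apply/cvgrPdist_le => e e0; near=> h.
    rewrite sub0r normrN [flat P 0]/flat ltxx subr0 addr0 [_ *: 1]mulr1 /flat.
    case: ifPn => h0; last by rewrite scaler0 normr0 ltW.
    have hi : 0 < h^-1 by rewrite invr_gt0.
    have := HC _ hi; rewrite !hornerE normrM exprVn => HC'.
    rewrite [_ *: _]/(_ * _) !normrM (gtr0_norm hi) (gtr0_norm (expR_gt0 _)).
    apply: (@le_trans _ _ (C * h)).
      move: HC'; rewrite gtr0_norm ?invr_gt0 ?exprn_gt0 // => HC'.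
      rewrite -ler_pdivrMr //; apply: le_trans HC'; rewrite le_eqVlt.
      by apply/orP; left; apply/eqP; field; rewrite gt_eqF.
    rewrite -ler_pdivlMl //; apply: le_trans (ler_norm _) _.
    near: h; apply: dnbhs0_le; by rewrite mulr_gt0 ?invr_gt0.
  by apply: DeriveDef; [apply/cvg_ex; exists 0|apply: cvg_lim].
Unshelve. all: by end_near. Qed.

(** The chain rule stays inside the family [flat], with lower order for the inner
    function. *)
Lemma Ck_flat m N (O : set 'rV[R]_m) (f : 'rV[R]_m -> R) P :
  open O -> Ck N O f -> Ck N O (fun x => flat P (f x)).
Proof.
move=> oO; have d1 Q t : differentiable (flat Q) t.
  apply/derivable1_diffP; exact: (@ex_derive _ _ _ _ _ _ _ (is_derive_flat Q t)).
have d2 Q g x : differentiable g x -> differentiable (fun x : 'rV[R]_m => flat Q (g x)) x.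
  by move=> dg; exact: (@differentiable_comp _ _ _ _ g (flat Q)).
elim: N P f => [|N IH] P f.
  by move=> cf [|//] x _ Ox; apply: d2; exact: (Ck0 cf).
move=> cf; have /CkS[df sf] := cf; apply/CkS; split=> [x Ox|v]; first exact: d2 (df _ Ox).
apply: (Ck_eq oO _ (CkM oO (sf v) (IH (flat_deriv P) f (CkW cf)))) => x Ox.
rewrite (@derive_chain _ _ _ _ (flat P) f x v) //; last exact: df.
have -> a : 'D_a (flat P) (f x) = a * 'D_1 (flat P) (f x).
  have := @deriveDr R R R (flat P) (f x) 1 0 a (d1 P (f x)).
  by rewrite addr0 derive0 addr0 [_ *: 1]mulr1.
by rewrite (@derive_val _ _ _ _ _ _ _ (is_derive_flat P (f x))).
Qed.

End Flat.

(** * Smooth functions on a manifold *)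

Section ManifoldCalculus.
Context {R : realType} {n : nat} (M : smoothManifold R n).
Implicit Types (p q r : M) (U V : set M) (f g : M -> R).

Lemma open_cimg p U : open U -> open (chart p @` (cdom p `&` U)).
Proof.
move=> oU; have -> : chart p @` (cdom p `&` U) =
    chart p @` cdom p `&` unchart p @^-1` U.
  apply/seteqP; split=> x /=.
    by move=> [q [pq Uq] <-]; split; [exists q|rewrite /= chartK].
  by move=> [[q pq <-]] /=; rewrite chartK // => Uq; exists q.
have oc := @cimg_open _ _ M p; have := @unchart_continuous _ _ M p.
by rewrite continuous_open_subspace // => /(continuous_inP _ oc); exact.
Qed.
Arguments open_cimg p [U] _.

Lemma open_chart_preim p (X : set 'rV[R]_n) :
  open X -> open (cdom p `&` chart p @^-1` X).
Proof.
move=> oX; have := @chart_continuous _ _ M p; have oc := @cdom_open _ _ M p.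
by rewrite continuous_open_subspace // => /(continuous_inP _ oc); exact.
Qed.

Lemma smooth_fun_sub U V f : V `<=` U -> smooth_fun U f -> smooth_fun V f.
Proof.
move=> VU sf p vs x [q [pq Vq] <-]; apply: sf.
by exists q => //; split=> //; exact: VU.
Qed.

Lemma smooth_fun_local U f :
  (forall q, U q -> exists2 V, V q & smooth_fun V f) -> smooth_fun U f.
Proof.
move=> H p vs x [q [pq /H[V Vq sf]] <-].
by apply: sf; exists q.
Qed.

Lemma smooth_fun_CkP U f :
  smooth_fun U f <-> forall p N, Ck N (chart p @` (cdom p `&` U)) (f \o unchart p).
Proof. by split=> sf p; apply/CkP; exact: sf. Qed.

Lemma smooth_fun_eq U f g :
  open U -> (forall q, U q -> f q = g q) -> smooth_fun U f -> smooth_fun U g.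
Proof.
move=> oU fg /smooth_fun_CkP sf; apply/smooth_fun_CkP => p N.
refine (Ck_eq (open_cimg p oU) _ (sf p N)) => x [q [pq Uq] <-] /=.
by rewrite chartK // fg.
Qed.

Lemma smooth_fun_cst U (c : R) : open U -> smooth_fun U (fun=> c).
Proof.
move=> oU; apply/smooth_fun_CkP => p N.
exact: Ck_cst (open_cimg p oU).
Qed.

Lemma smooth_funD U f g : open U -> smooth_fun U f -> smooth_fun U g ->
  smooth_fun U (fun q => f q + g q).
Proof.
move=> oU /smooth_fun_CkP sf /smooth_fun_CkP sg; apply/smooth_fun_CkP => p N.
exact: (CkD (open_cimg p oU) (sf p N) (sg p N)).
Qed.

Lemma smooth_funM U f g : open U -> smooth_fun U f -> smooth_fun U g ->
  smooth_fun U (fun q => f q * g q).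
Proof.
move=> oU /smooth_fun_CkP sf /smooth_fun_CkP sg; apply/smooth_fun_CkP => p N.
exact: (CkM (open_cimg p oU) (sf p N) (sg p N)).
Qed.

Lemma smooth_fun_sum U (I : Type) (s : seq I) (P : pred I) (f : I -> M -> R) :
  open U -> (forall i, P i -> smooth_fun U (f i)) ->
  smooth_fun U (fun q => \sum_(i <- s | P i) f i q).
Proof.
move=> oU sf; elim: s => [|i s IH].
  by apply: (smooth_fun_eq oU _ (smooth_fun_cst 0 oU)) => q _; rewrite big_nil.
case Pi: (P i).
  apply: (smooth_fun_eq oU _ (smooth_funD oU (sf i Pi) IH)) => q _.
  by rewrite big_cons Pi.
by apply: (smooth_fun_eq oU _ IH) => q _; rewrite big_cons Pi.
Qed.

Lemma smooth_fun_flat U f P : open U -> smooth_fun U f ->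
  smooth_fun U (fun q => flat P (f q)).
Proof.
move=> oU /smooth_fun_CkP sf; apply/smooth_fun_CkP => p N.
exact: (Ck_flat P (open_cimg p oU) (sf p N)).
Qed.

Lemma smooth_fun_coord p (i : 'I_n) : smooth_fun (cdom p) (fun q => chart p q 0 i).
Proof. by move=> r; exact: transition_smooth. Qed.

Lemma smooth_fun_differentiable U f p q :
  smooth_fun U f -> U q -> cdom p q -> differentiable (f \o unchart p) (chart p q).
Proof. by move=> sf Uq pq; apply: (sf p [::]); exists q. Qed.

(** The derivative at [q] of the change of charts from [p] to [r].  It carries
    coordinates in the chart [p] of a tangent vector at [q] to its coordinates in the
    chart [r]; [coordvec p q] is the case [r = q]. *)
Definition dtrans p r q (v : 'rV[R]_n) : 'rV[R]_n :=
  'D_v (fun x => chart r (unchart p x)) (chart p q).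

Lemma dtrans_differentiable p r q : cdom p q -> cdom r q ->
  differentiable (fun x => chart r (unchart p x)) (chart p q).
Proof.
move=> pq rq; apply: differentiable_rV => i.
exact: (smooth_fun_differentiable (@smooth_fun_coord r i)).
Qed.

(** On the common domain, [f] read in the chart [p] is [f] read in the chart [r]
    after the change of charts. *)
Lemma chart_chain (W : normedModType R) (f : M -> W) p r q v :
  cdom p q -> cdom r q -> differentiable (f \o unchart r) (chart r q) ->
  'D_v (f \o unchart p) (chart p q) = 'D_(dtrans p r q v) (f \o unchart r) (chart r q).
Proof.
move=> pq rq df.
have oO := open_cimg p (@cdom_open _ _ M r).
rewrite (@derive_eq_on _ _ _ _ _
    ((f \o unchart r) \o (fun x => chart r (unchart p x))) v _ oO).
- rewrite derive_chain /= ?chartK //; exact: dtrans_differentiable.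
- by move=> x [y [py ry] <-] /=; rewrite !chartK.
- by exists q.
Qed.

Lemma dtrans_comp p r s q v : cdom p q -> cdom r q -> cdom s q ->
  dtrans r s q (dtrans p r q v) = dtrans p s q v.
Proof.
move=> pq rq sq; rewrite [RHS](@chart_chain _ (chart s) _ r) //.
exact: dtrans_differentiable.
Qed.

Lemma dtrans_id p q v : cdom p q -> dtrans p p q v = v.
Proof.
move=> pq; rewrite /dtrans (@derive_eq_on _ _ _ _ _ id v _ (@cimg_open _ _ M p)).
- exact: derive_id.
- by move=> x [y py <-] /=; rewrite chartK.
- by exists q.
Qed.

Lemma dtrans_sum p r q v : cdom p q -> cdom r q ->
  dtrans p r q v = \sum_(i < n) v 0 i *: dtrans p r q (delta_mx 0 i).
Proof.
move=> pq rq; rewrite /dtrans deriveE; last exact: dtrans_differentiable.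
rewrite {1}[v]row_sum_delta linear_sum; apply: eq_bigr => i _.
by rewrite linearZ deriveE //; exact: dtrans_differentiable.
Qed.

Lemma coordvecE p q : coordvec p q = dtrans p q q.
Proof. by []. Qed.

Definition pder p (v : 'rV[R]_n) f q : R := 'D_v (f \o unchart p) (chart p q).

(** In another chart the derivative is itself composed with the change of charts. *)
Lemma smooth_fun_pder U p v f : open U -> U `<=` cdom p -> smooth_fun U f ->
  smooth_fun U (pder p v f).
Proof.
move=> oU Up sf; apply/smooth_fun_CkP => r N.
have oQ := open_cimg p oU.
have oO := open_cimg r oU.
apply: (@Ck_comp _ _ _ _ _ (chart p @` (cdom p `&` U)) ('D_v (f \o unchart p)) (fun x => chart p (unchart r x)) oO oQ).
- by move=> x [q [rq Uq] <-] /=; exists q; [split=> //; exact: Up|rewrite chartK].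
- have /smooth_fun_CkP /(_ p N.+1) /CkS[_ H] := sf; exact: H.
- have : forall i, smooth_fun U (fun q => chart p q 0 i).
    by move=> i; apply: smooth_fun_sub Up (@smooth_fun_coord p i).
  by move=> H i; have /smooth_fun_CkP := H i; exact.
Qed.

Lemma smooth_fun_dtrans p r v (i : 'I_n) :
  smooth_fun (cdom p `&` cdom r) (fun q => dtrans p r q v 0 i).
Proof.
have oU := openI (@cdom_open _ _ M p) (@cdom_open _ _ M r).
have := @smooth_fun_pder _ p v (fun q => chart r q 0 i) oU (@subIsetl _ _ _)
  (smooth_fun_sub (@subIsetr _ _ _) (@smooth_fun_coord r i)).
apply: smooth_fun_eq => // q [pq rq].
by rewrite /dtrans derive_rV //; exact: dtrans_differentiable.
Qed.

Lemma pder_chart p q v f : cdom p q ->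
  differentiable (f \o unchart q) (chart q q) ->
  'D_(coordvec p q v) (f \o unchart q) (chart q q) = pder p v f q.
Proof.
by move=> pq df; rewrite /pder [RHS](chart_chain _ pq (@cdom_center _ _ M q)).
Qed.

(** A smooth step from 1 (for t <= 1) to 0 (for t >= 2).  It composes exp(-1/t)
    with itself instead of dividing by a sum of two such functions, so that only
    composition is needed for its smoothness. *)
Definition bump_step (t : R) : R :=
  flat 1 (1 - flat 1 (t - 1) / flat 1 1) / flat 1 1.

Lemma flat1_gt0 : 0 < flat 1 (1 : R).
Proof. by rewrite /flat ltr01 hornerC mul1r expR_gt0. Qed.

Lemma flat_le0 P (t : R) : t <= 0 -> flat P t = 0.
Proof. by rewrite /flat ltNge => ->. Qed.

Lemma bump_step1 t : t <= 1 -> bump_step t = 1.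
Proof.
move=> t1; rewrite /bump_step (@flat_le0 _ (t - 1)) ?subr_le0 // mul0r subr0.
by rewrite divff // gt_eqF // flat1_gt0.
Qed.

Lemma bump_step0 t : 2 <= t -> bump_step t = 0.
Proof.
move=> t2; rewrite /bump_step (@flat_le0 _ (1 - _)) ?mul0r //.
rewrite subr_le0 ler_pdivlMr ?flat1_gt0 // mul1r.
have t0 : 1 <= t - 1 by rewrite lerBrDr.
have t0' : 0 < t - 1 by apply: lt_le_trans t0.
rewrite /flat t0' ltr01 !hornerC !mul1r ler_expR lerN2.
by rewrite lef_pV2 ?posrE.
Qed.

(** The bump is a step of the squared distance to [q] in the chart at [q], extended
    by 0.  It vanishes outside the image of a compact ball, which is closed because the
    manifold is Hausdorff; this is why the extension by 0 is smooth.  The open set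
    [W] is the complement of that image. *)
Lemma exists_bump U q : open U -> U q ->
  exists (chi : M -> R) V W, [/\ smooth_fun setT chi,
    [/\ open V, V q, V `<=` U & forall z, V z -> chi z = 1] &
    [/\ open W, forall z, U z \/ W z & forall z, W z -> chi z = 0]].
Proof.
move=> oU Uq; pose a := chart q q.
pose Uo := cdom q `&` U.
have oUo : open Uo by apply: openI => //; exact: cdom_open.
have Ua : (chart q @` Uo) a by exists q => //; split=> //; exact: cdom_center.
have oO := open_cimg q oU.
have /nbhs_ballP[r /= r0 rO] := open_nbhs_nbhs (conj oO Ua).
pose rho (x : 'rV[R]_n) : R := \sum_(i < n) (x 0 i - a 0 i) * (x 0 i - a 0 i).
(* The step of [c * rho] is 1 where [rho <= 1 / c], and 0 where
   [rho >= 2 / c = r ^+ 2 / 4], that is, outside [K] defined below. *)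
pose c := 8 / (r ^+ 2).
have c0 : 0 < c by rewrite divr_gt0 // exprn_gt0.
have drho x : differentiable rho x.
  have dc i y : differentiable (fun x : 'rV[R]_n => x 0 i - a 0 i) y.
    by apply: differentiableB; [exact: differentiable_coord|exact: differentiable_cst].
  apply: (@Ck0 _ _ 0 setT) => //; apply: Ck_sum => [|i]; first exact: openT.
  by move=> [|//] y _ _; exact: (differentiableM (dc i y) (dc i y)).
have crho : continuous rho by move=> x; exact: differentiable_continuous.
(* The sum of squares bounds the square of each coordinate, so [K] lies in
   the closed ball of radius [r / 2] for the maximum norm. *)
pose K := rho @^-1` [set t | t <= r ^+ 2 / 4].
have Kball x : K x -> ball a r x.
  move=> Kx; rewrite -ball_normE /= distrC; apply: (@le_lt_trans _ _ (r / 2)); last first.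
    by rewrite ltr_pdivrMr // ltr_pMr // ltr1n.
  rewrite /Num.Def.normr /= mx_normrE; apply: bigmax_le => [|[i j] _ /=].
    by rewrite divr_ge0 // ltW.
  rewrite (ord1 i) !mxE -(@ler_pXn2r _ 2) ?nnegrE ?divr_ge0 ?(ltW r0) //.
  rewrite real_normK ?num_real // expr_div_n -[2 ^+ 2]/(2 * 2) -natrM.
  apply: le_trans Kx; rewrite /rho (bigD1 j) //= expr2 lerDl sumr_ge0 // => k _.
  by rewrite -expr2 sqr_ge0.
have KO x : K x -> (chart q @` Uo) x by move=> /Kball /rO.
have cK : compact K.
  apply: bounded_closed_compact.
    exists (`|a| + r); split; first by rewrite num_real.
    move=> N aN x /Kball; rewrite -ball_normE /= => xa; apply: ltW; apply: le_lt_trans aN.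
    rewrite -[x](subrK a) addrC; apply: le_trans (ler_normD _ _) _.
    by rewrite lerD2l distrC ltW.
  apply: closed_comp => [x _|]; [exact: crho|exact: closed_le].
pose W := ~` (unchart q @` K).
have oW : open W.
  apply: closed_openC; apply: compact_closed; first exact: manifold_hausdorff.
  apply: continuous_compact => //.
  apply: continuous_subspaceW (@unchart_continuous _ _ M q) => x /KO[z [qz _] <-].
  by exists z.
have UW z : Uo z \/ W z.
  have [[x Kx <-]|Wz] := pselect ((unchart q @` K) z); last by right.
  by left; have [y [qy Uy] <-] := KO x Kx; rewrite chartK.
pose chi z : R := if z \in Uo then bump_step (c * rho (chart q z)) else 0.
have chiU z : Uo z -> chi z = bump_step (c * rho (chart q z)).
  by move=> Uz; rewrite /chi ifT // inE.
have chiW z : W z -> chi z = 0.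
  move=> Wz; rewrite /chi; case: ifPn => //; rewrite inE => -[qz Uz].
  have /negP : ~ K (chart q z) by move=> Kz; apply: Wz; exists (chart q z); rewrite ?chartK.
  rewrite -ltNge => Kz; apply: bump_step0.
  rewrite /c -mulrA -ler_pdivrMl // ler_pdivlMl ?exprn_gt0 //.
  apply: ltW; apply: le_lt_trans Kz; rewrite le_eqVlt; apply/orP; left; apply/eqP.
  by field.
pose B := [set x | rho x < c^-1].
have oB : open B.
  rewrite (_ : B = rho @^-1` [set t | t < c^-1]) //.
  by apply: open_comp => [x _|]; [exact: crho|exact: open_lt].
exists chi, ((cdom q `&` chart q @^-1` B) `&` U), W; split.
- apply: smooth_fun_local => z _; case: (UW z) => [Uz|Wz]; last first.
    by exists W => //; apply: (smooth_fun_eq oW _ (smooth_fun_cst 0 oW)) => y /chiW.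
  exists Uo => //.
  have sr : smooth_fun Uo (fun z => c * rho (chart q z)).
    apply: smooth_funM => //; first exact: smooth_fun_cst.
    have sc i : smooth_fun Uo (fun z => chart q z 0 i - a 0 i).
      apply: smooth_funD => //; last exact: smooth_fun_cst.
      exact: smooth_fun_sub (@subIsetl _ _ _) (@smooth_fun_coord q i).
    by apply: smooth_fun_sum => // i _; exact: smooth_funM.
  apply: (@smooth_fun_eq _ (fun z => bump_step (c * rho (chart q z)))) => //.
    by move=> y Uy; rewrite chiU.
  apply: smooth_funM => //; last exact: smooth_fun_cst.
  apply: smooth_fun_flat => //; apply: smooth_funD => //; first exact: smooth_fun_cst.
  have E : forall z, - (flat 1 (c * rho (chart q z) - 1) / flat 1 1) =
      flat 1 (c * rho (chart q z) - 1) * - (flat 1 1)^-1.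
    by move=> y; rewrite mulrN.
  apply: (smooth_fun_eq oUo (fun y _ => esym (E y))).
  apply: smooth_funM => //; last exact: smooth_fun_cst.
  apply: smooth_fun_flat => //; apply: smooth_funD => //; exact: smooth_fun_cst.
- split.
  + by apply: openI => //; exact: open_chart_preim.
  + split=> //; split; first exact: cdom_center.
    rewrite /= /B /= /rho big1 ?invr_gt0 // => i _.
    by rewrite -/a subrr mul0r.
  + by move=> z [].
  + move=> z [[qz Bz] Uz]; rewrite chiU //; apply: bump_step1.
    by rewrite -ler_pdivlMl // mulr1 ltW.
- by split=> // z; case: (UW z) => [[]|]; [left|right].
Qed.

End ManifoldCalculus.

(** * Shuffle products *)

Lemma nuniq_split (A : eqType) (s : seq A) : ~~ uniq s ->
  exists x s1 s2 s3, s = s1 ++ x :: s2 ++ x :: s3.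
Proof.
elim: s => [//|x s IH] /=; rewrite negb_and negbK.
case/orP => [xs|/IH[y [s1 [s2 [s3 ->]]]]].
  by case/splitPr: xs => s1 s2; exists x, [::], s1, s2.
by exists y, (x :: s1), s2, s3.
Qed.

Section Shuffle.
Context {R : realType} {n : nat}.
Local Notation T := 'rV[R]_n.
Implicit Types (vs s t r : seq T) (u v : T).

(** The sign (-1)^(k d) on the component of degree d.  It is the sign for moving a
    factor of degree k past a form. *)
Definition sgn_deg {U : lmodType R} (k : nat) (f : seq T -> U) : seq T -> U :=
  fun t => (-1) ^+ (k * size t) *: f t.

(** Insertion of [v] in the first argument: the interior product. *)
Definition ins {U : Type} v (f : seq T -> U) : seq T -> U := fun t => f (v :: t).

(** The sum over shuffles by recursion on the list: the first vector goes either
    to [f] or, at the cost of the sign for passing over the arguments of [f], to [g].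
    In terms of interior products this is the graded Leibniz rule. *)
Fixpoint shuffle {U V W : lmodType R} (op : U -> V -> W)
    (f : seq T -> U) (g : seq T -> V) (vs : seq T) {struct vs} : W :=
  match vs with
  | [::] => op (f [::]) (g [::])
  | v :: vs' => shuffle op (ins v f) g vs' + shuffle op (sgn_deg 1 f) (ins v g) vs'
  end.

Definition homog {U : lmodType R} k (f : seq T -> U) : Prop :=
  forall t, size t != k -> f t = 0.

Record bilin {U V W : lmodType R} (op : U -> V -> W) : Prop := Bilin {
  bilinl : forall (a : R) (x x' : U) (y : V), op (a *: x + x') y = a *: op x y + op x' y;
  bilinr : forall (a : R) (x : U) (y y' : V), op x (a *: y + y') = a *: op x y + op x y'
}.

Section Sgn.
Variable U : lmodType R.
Implicit Type f : seq T -> U.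

Lemma sgn_degK k f : sgn_deg k (sgn_deg k f) = f.
Proof.
apply/funext => t; rewrite /sgn_deg scalerA -exprMn mulrNN mulr1 expr1n.
by rewrite scale1r.
Qed.

Lemma sgn_deg_comp k l f : sgn_deg k (sgn_deg l f) = sgn_deg (k + l) f.
Proof. by apply/funext => t; rewrite /sgn_deg scalerA -exprD mulnDl. Qed.

Lemma ins_sgn k v f : ins v (sgn_deg k f) = (fun t => (-1) ^+ k *: sgn_deg k (ins v f) t).
Proof.
by apply/funext => t; rewrite /ins /sgn_deg /= mulnS exprD scalerA.
Qed.

Lemma sgn_homog k l f : homog l f -> sgn_deg k f = (fun t => (-1) ^+ (k * l) *: f t).
Proof.
move=> hf; apply/funext => t; rewrite /sgn_deg.
by have [->//|/hf ->] := eqVneq (size t) l; rewrite !scaler0.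
Qed.

Lemma ins_homog0 v f : homog 0 f -> ins v f = fun=> 0.
Proof. by move=> hf; apply/funext => t; apply: hf. Qed.

Lemma ins_homog k v f : homog k.+1 f -> homog k (ins v f).
Proof. by move=> hf t ht; apply: hf. Qed.

End Sgn.

Section OneProduct.
Variables (U V W : lmodType R) (op : U -> V -> W).
Hypothesis bop : bilin op.
Implicit Types (f : seq T -> U) (g : seq T -> V).

Lemma bilin0l y : op 0 y = 0.
Proof.
by have := bilinl bop (-1) 0 0 y; rewrite scaler0 addr0 scaleN1r addNr.
Qed.

Lemma bilinZl a x y : op (a *: x) y = a *: op x y.
Proof. by have := bilinl bop a x 0 y; rewrite bilin0l !addr0. Qed.

Lemma shuffle_linl a f f' g vs :
  shuffle op (fun t => a *: f t + f' t) g vs = a *: shuffle op f g vs + shuffle op f' g vs.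
Proof.
elim: vs f f' g => [|v vs IH] f f' g /=; first exact: bilinl.
rewrite -[ins v (fun t => _ + _)]/(fun t => a *: ins v f t + ins v f' t) IH.
have -> : sgn_deg 1 (fun t => a *: f t + f' t) =
    (fun t => a *: sgn_deg 1 f t + sgn_deg 1 f' t).
  apply/funext => t; rewrite /sgn_deg scalerDr !scalerA; congr (_ *: _ + _).
  exact: mulrC.
by rewrite IH scalerDr addrACA.
Qed.

Lemma shuffle_linr a f g g' vs :
  shuffle op f (fun t => a *: g t + g' t) vs = a *: shuffle op f g vs + shuffle op f g' vs.
Proof.
elim: vs f g g' => [|v vs IH] f g g' /=; first exact: bilinr.
rewrite -[ins v (fun t => _ + _)]/(fun t => a *: ins v g t + ins v g' t) !IH.
by rewrite scalerDr addrACA.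
Qed.

Lemma shuffle0l g vs : shuffle op (fun=> 0) g vs = 0.
Proof.
have := shuffle_linl (-1) (fun=> 0) (fun=> 0) g vs.
by rewrite scaler0 addr0 scaleN1r addNr.
Qed.

Lemma shuffle0r f vs : shuffle op f (fun=> 0) vs = 0.
Proof.
have := shuffle_linr (-1) f (fun=> 0) (fun=> 0) vs.
by rewrite scaler0 addr0 scaleN1r addNr.
Qed.

Lemma shuffleZl a f g vs : shuffle op (fun t => a *: f t) g vs = a *: shuffle op f g vs.
Proof.
have := shuffle_linl a f (fun=> 0) g vs; rewrite shuffle0l addr0 => <-.
by congr (shuffle _ _ _ _); apply/funext => t; rewrite addr0.
Qed.

Lemma shuffleZr a f g vs : shuffle op f (fun t => a *: g t) vs = a *: shuffle op f g vs.
Proof.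
have := shuffle_linr a f g (fun=> 0) vs; rewrite shuffle0r addr0 => <-.
by congr (shuffle _ _ _ _); apply/funext => t; rewrite addr0.
Qed.

Lemma shuffle_sgn k f g vs :
  shuffle op (sgn_deg k f) (sgn_deg k g) vs = sgn_deg k (shuffle op f g) vs.
Proof.
elim: vs f g => [|v vs IH] f g; first by rewrite /sgn_deg /= muln0 !scale1r.
rewrite /= !ins_sgn shuffleZl shuffleZr sgn_deg_comp addnC -sgn_deg_comp !IH.
by rewrite -scalerDr -scalerDr scalerA -exprD -mulnS.
Qed.

Lemma sum_bool_tuple m (F : bitseq -> W) :
  \sum_(t : m.+1.-tuple bool) F t =
  \sum_(t : m.-tuple bool) F (true :: t) + \sum_(t : m.-tuple bool) F (false :: t).
Proof.
rewrite (reindex (fun p : bool * m.-tuple bool => [tuple of p.1 :: p.2])) /=; last first.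
  exists (fun t : m.+1.-tuple bool => (thead t, [tuple of behead t])) => [[b t] _|t _].
    by congr (_, _); apply: val_inj.
  by apply: val_inj; rewrite /= [t in RHS]tuple_eta.
rewrite -(pair_bigA _ (fun (b : bool) (t : m.-tuple bool) => F (b :: t))) /=.
by rewrite big_bool.
Qed.

(** Identifies the recursion with the sum over selections of positions.  A position
    that is not selected counts as many inversions as there are selected positions
    after it. *)
Lemma shuffle_sum f g vs : shuffle op f g vs =
  \sum_(m : (size vs).-tuple bool) (-1) ^+ mask_inv m *:
     op (f (mask m vs)) (g (mask (map negb m) vs)).
Proof.
elim: vs f g => [|v vs IH] f g /=.
  rewrite (big_pred1 [tuple]) => [|t]; last by apply/esym/eqP; exact: tuple0.
  by rewrite /= scale1r.
rewrite (@sum_bool_tuple (size vs) (fun m : bitseq => (-1) ^+ mask_inv m *: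
     op (f (mask m (v :: vs))) (g (mask (map negb m) (v :: vs))))) /= !IH.
congr (_ + _); apply: eq_bigr => m _.
rewrite /sgn_deg mul1n size_mask ?size_tuple // exprD [_ ^+ _ * _]mulrC -scalerA.
by rewrite bilinZl.
Qed.

End OneProduct.

Lemma sgn_lin (U : lmodType R) k (a : R) (f f' : seq T -> U) :
  sgn_deg k (fun t => a *: f t + f' t) = (fun t => a *: sgn_deg k f t + sgn_deg k f' t).
Proof.
by apply/funext => t; rewrite /sgn_deg scalerDr !scalerA mulrC.
Qed.

(** Both sides distribute the first vector over the three factors with the same
    signs, as [sgn_deg 1] is multiplicative. *)
Lemma shuffle_assoc (U V W X Y Z : lmodType R)
    (op1 : U -> V -> X) (op2 : X -> W -> Z) (op3 : V -> W -> Y) (op4 : U -> Y -> Z)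
    (f : seq T -> U) (g : seq T -> V) (h : seq T -> W) vs :
  bilin op1 -> bilin op2 -> bilin op3 -> bilin op4 ->
  (forall x y z, op4 x (op3 y z) = op2 (op1 x y) z) ->
  shuffle op4 f (shuffle op3 g h) vs = shuffle op2 (shuffle op1 f g) h vs.
Proof.
move=> b1 b2 b3 b4 opA; elim: vs f g h => [|v vs IH] f g h /=; first exact: opA.
have E3 : ins v (shuffle op3 g h) =
    (fun t => 1 *: shuffle op3 (ins v g) h t + shuffle op3 (sgn_deg 1 g) (ins v h) t).
  by apply/funext => t; rewrite scale1r.
have E1 : ins v (shuffle op1 f g) =
    (fun t => 1 *: shuffle op1 (ins v f) g t + shuffle op1 (sgn_deg 1 f) (ins v g) t).
  by apply/funext => t; rewrite scale1r.
rewrite E3 E1 shuffle_linr // shuffle_linl // !scale1r !IH addrA; congr (_ + _).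
by congr (shuffle _ _ _ _); apply/funext => t; rewrite shuffle_sgn.
Qed.

(** Graded commutativity, with the sign spread over the components of the first
    factor, so that it applies to endomorphism-valued forms of mixed degree. *)
Lemma shuffle_swap (U V W : lmodType R) (op : U -> V -> W) (op' : V -> U -> W)
    l (f : seq T -> U) (g : seq T -> V) vs :
  bilin op -> bilin op' -> (forall x y, op x y = op' y x) -> homog l g ->
  shuffle op f g vs = shuffle op' g (sgn_deg l f) vs.
Proof.
move=> b b' opC; elim: vs l f g => [|v vs IH] l f g hg /=.
  by rewrite opC /sgn_deg muln0 scale1r.
rewrite addrC; congr (_ + _).
  case: l hg => [|l] hg; first by rewrite ins_homog0 // shuffle0r // shuffle0l.
  by rewrite (IH l) ?sgn_deg_comp ?addn1 //; exact: ins_homog.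
rewrite (sgn_homog 1 hg) ins_sgn mul1n shuffleZl // shuffleZr // scalerA -exprMn.
by rewrite mulrNN mulr1 expr1n scale1r (IH l).
Qed.

Section Alternating.

Section Closure.
Variable U : lmodType R.
Implicit Type f : seq T -> U.

Lemma multilinear_ins v f : multilinear f -> multilinear (ins v f).
Proof. by move=> mf s t a u w; rewrite /ins -!cat_cons mf. Qed.

Lemma alternating_ins v f : Defs.alternating f -> Defs.alternating (ins v f).
Proof. by move=> mf s t r u; rewrite /ins -cat_cons mf. Qed.

Lemma multilinear_sgn k f : multilinear f -> multilinear (sgn_deg k f).
Proof.
move=> mf s t a u w; rewrite /sgn_deg !size_cat /= mf scalerDr !scalerA.
by rewrite [a * _]mulrC.
Qed.

Lemma alternating_sgn k f : Defs.alternating f -> Defs.alternating (sgn_deg k f).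
Proof. by move=> mf s t r u; rewrite /sgn_deg mf scaler0. Qed.

(** Polarization of the vanishing on repeated arguments. *)
Lemma alternatingC u v f : multilinear f -> Defs.alternating f ->
  ins v (ins u f) = (fun t => -1 *: ins u (ins v f) t).
Proof.
move=> mf af; apply/funext => t; apply/eqP; rewrite scaleN1r -addr_eq0 /ins.
have := af [::] [::] t (u + v); have := mf [::] (u + v :: t) 1 u v.
rewrite /= !scale1r => ->; have := mf [:: u] t 1 u v; have := mf [:: v] t 1 u v.
rewrite /= !scale1r => -> ->; have := af [::] [::] t u; have := af [::] [::] t v => /= -> ->.
by rewrite add0r addr0 addrC => ->.
Qed.

Lemma alternating_ins2 u f : Defs.alternating f -> ins u (ins u f) = fun=> 0.
Proof. by move=> af; apply/funext => t; exact: (af [::] [::]). Qed.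

Lemma multilinear0 f s t : multilinear f -> f (s ++ 0 :: t) = 0.
Proof.
by move=> mf; have := mf s t (-1) 0 0; rewrite scaler0 addr0 scaleN1r addNr.
Qed.

Lemma multilinear_sum (I : Type) (e : seq I) (a : I -> R) (x : I -> T) f s t :
  multilinear f ->
  f (s ++ (\sum_(i <- e) a i *: x i) :: t) = \sum_(i <- e) a i *: f (s ++ x i :: t).
Proof.
move=> mf; elim: e => [|i e IH]; first by rewrite !big_nil multilinear0.
by rewrite !big_cons mf IH.
Qed.

(** Expand every argument in the standard basis; in a list of more than [n] basis
    vectors one of them is repeated. *)
Lemma alternating_vanish f vs : multilinear f -> Defs.alternating f ->
  (n < size vs)%N -> f vs = 0.
Proof.
move=> mf af; pose e (i : 'I_n) : T := delta_mx 0 i.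
suff H t (is_ : seq 'I_n) : (n < size is_ + size t)%N -> f (map e is_ ++ t) = 0.
  by move=> /(H vs [::]).
elim: t is_ => [|v t IH] is_ ns.
  have /nuniq_split[i [s1 [s2 [s3 ->]]]] : ~~ uniq is_.
    apply/negP => /card_uniqP us; have := max_card (mem is_).
    by rewrite us card_ord leqNgt -[size is_]addn0 ns.
  by rewrite cats0 !(map_cat, map_cons) af.
rewrite [v]row_sum_delta multilinear_sum // big1 // => i _.
rewrite -/(e i) -cat_rcons -map_rcons IH ?scaler0 // size_rcons.
by rewrite addSnnS.
Qed.

End Closure.

Variables (U V W : lmodType R) (op : U -> V -> W).
Hypothesis bop : bilin op.
Implicit Types (f : seq T -> U) (g : seq T -> V).

Lemma multilinear_shuffle f g : multilinear f -> multilinear g ->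
  multilinear (shuffle op f g).
Proof.
move=> mf mg s t a u w; elim: s f g mf mg => [|v s IH] f g mf mg /=.
  have -> : ins (a *: u + w) f = (fun r => a *: ins u f r + ins w f r).
    by apply/funext => r; exact: (mf [::]).
  have -> : ins (a *: u + w) g = (fun r => a *: ins u g r + ins w g r).
    by apply/funext => r; exact: (mg [::]).
  by rewrite shuffle_linl // shuffle_linr // scalerDr addrACA.
rewrite !IH; first by rewrite scalerDr addrACA.
- exact: multilinear_sgn.
- exact: multilinear_ins.
- exact: multilinear_ins.
- done.
Qed.

(** Induction on the list between the two equal vectors.  Exchanging the vector that
    follows with the repeated one changes the sign of all four terms, which then match
    two instances of the induction hypothesis. *)
Lemma alternating_shuffle_head f g u t r :
  multilinear f -> Defs.alternating f -> multilinear g -> Defs.alternating g ->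
  shuffle op f g (u :: t ++ u :: r) = 0.
Proof.
rewrite /=; elim: t f g => [|x t IH] f g mf af mg ag /=.
  rewrite sgn_degK !alternating_ins2 // shuffle0l // shuffle0r // add0r addr0.
  by rewrite ins_sgn shuffleZl // expr1 scaleN1r addrN.
have E : sgn_deg 1 (ins u f) = (fun y => -1 *: ins u (sgn_deg 1 f) y).
  by rewrite ins_sgn; apply/funext => y; rewrite expr1 scalerA mulrNN mulr1 scale1r.
rewrite (alternatingC u x mf af) (alternatingC u x mg ag) E (ins_sgn 1 x) expr1.
rewrite !shuffleZl // !shuffleZr // addrACA -!scalerDr.
rewrite (IH (ins x f) g) ?(IH (sgn_deg 1 f) (ins x g)) ?addr0 ?scaler0 //.
- exact: multilinear_sgn.
- exact: alternating_sgn.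
- exact: multilinear_ins.
- exact: alternating_ins.
- exact: multilinear_ins.
- exact: alternating_ins.
Qed.

Lemma alternating_shuffle f g :
  multilinear f -> Defs.alternating f -> multilinear g -> Defs.alternating g ->
  Defs.alternating (shuffle op f g).
Proof.
move=> mf af mg ag s t r u; elim: s f g mf af mg ag => [|v s IH] f g mf af mg ag.
  exact: alternating_shuffle_head.
rewrite /= !IH ?addr0 //.
- exact: multilinear_sgn.
- exact: alternating_sgn.
- exact: multilinear_ins.
- exact: alternating_ins.
- exact: multilinear_ins.
- exact: alternating_ins.
Qed.

End Alternating.
End Shuffle.

(** * Smooth sections of bundles *)

Lemma pair_sum_l (R : pzRingType) (U V : lmodType R) (I : Type) (r : seq I)
    (c : I -> R) (u : I -> U) :
  (\sum_(i <- r) c i *: u i, 0 : V) = \sum_(i <- r) c i *: (u i, 0) :> U * V.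
Proof.
elim/big_rec2: _ => [//|i x y _ <-].
by congr pair; rewrite /= ?scaler0 ?addr0.
Qed.

Lemma pair_sum_r (R : pzRingType) (U V : lmodType R) (I : Type) (r : seq I)
    (c : I -> R) (v : I -> V) :
  (0 : U, \sum_(i <- r) c i *: v i) = \sum_(i <- r) c i *: (0, v i) :> U * V.
Proof.
elim/big_rec2: _ => [//|i x y _ <-].
by congr pair; rewrite /= ?scaler0 ?addr0.
Qed.

Section Sections.
Context {R : realType} {n : nat} {M : smoothManifold R n}.

Section VBundle.
Variable E : vbundle M.
Implicit Types (U V : set M) (s : forall q, E q).

Lemma section_sub U V s : V `<=` U -> smooth_section U s -> smooth_section V s.
Proof. by move=> VU ss p a; apply: smooth_fun_sub (ss p a) => q [/VU]. Qed.

Lemma open_fdomI U p : open U -> open (U `&` fdom E p).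
Proof. by move=> oU; apply: openI => //; exact: fdom_open. Qed.

Lemma section_local U s : (forall q, U q -> exists2 V, V q & smooth_section V s) ->
  smooth_section U s.
Proof.
move=> H p a; apply: smooth_fun_local => q [/H[V Vq sV] pq].
by exists (V `&` fdom E p).
Qed.

Lemma section_eq U s s' : open U -> (forall q, U q -> s q = s' q) ->
  smooth_section U s -> smooth_section U s'.
Proof.
move=> oU ss' ss p a; apply: smooth_fun_eq (ss p a); first exact: open_fdomI.
by move=> q [/ss' ->].
Qed.

Lemma section0 U : open U -> smooth_section U (fun q => 0 : E q).
Proof.
move=> oU p a; have o := open_fdomI p oU.
by apply: (smooth_fun_eq o _ (smooth_fun_cst 0 o)) => q _; rewrite linear0.
Qed.

Lemma sectionD U s s' : open U -> smooth_section U s -> smooth_section U s' ->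
  smooth_section U (fun q => s q + s' q).
Proof.
move=> oU ss ss' p a; have o := open_fdomI p oU.
by apply: (smooth_fun_eq o _ (smooth_funD o (ss p a) (ss' p a))) => q _; rewrite linearD.
Qed.

Lemma sectionZ U (f : M -> R) s : open U -> smooth_fun U f -> smooth_section U s ->
  smooth_section U (fun q => f q *: s q).
Proof.
move=> oU sf ss p a; have o := open_fdomI p oU.
have sf' := smooth_fun_sub (@subIsetl _ U (fdom E p)) sf.
by apply: (smooth_fun_eq o _ (smooth_funM o sf' (ss p a))) => q _; rewrite linearZ.
Qed.

Lemma section_frame p a : smooth_section (fdom E p) (fun q => tnth (frame E p q) a).
Proof. by move=> p' b; rewrite setIC; exact: frame_smooth. Qed.

End VBundle.

Section SBundle.
Variable E : superbundle M.
Local Notation fib := (sfiber E).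
Implicit Types (U V : set M) (s : forall q, fib q).

Lemma ssection_sub U V s : V `<=` U -> smooth_ssection U s -> smooth_ssection V s.
Proof. by move=> VU [s1 s2]; split; exact: section_sub VU _. Qed.

Lemma ssection_local U s : (forall q, U q -> exists2 V, V q & smooth_ssection V s) ->
  smooth_ssection U s.
Proof.
by move=> H; split; apply: section_local => q /H[V Vq [s1 s2]]; exists V.
Qed.

Lemma ssection_eq U s s' : open U -> (forall q, U q -> s q = s' q) ->
  smooth_ssection U s -> smooth_ssection U s'.
Proof.
by move=> oU ss' [s1 s2]; split; [apply: section_eq s1|apply: section_eq s2] => // q /ss' ->.
Qed.

Lemma ssection0 U : open U -> smooth_ssection U (fun q => 0 : fib q).
Proof. by move=> oU; split; exact: section0. Qed.

Lemma ssectionD U s s' : open U -> smooth_ssection U s -> smooth_ssection U s' ->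
  smooth_ssection U (fun q => s q + s' q).
Proof. by move=> oU [s1 s2] [s1' s2']; split; exact: sectionD. Qed.

Lemma ssectionZ U (f : M -> R) s : open U -> smooth_fun U f -> smooth_ssection U s ->
  smooth_ssection U (fun q => f q *: s q).
Proof. by move=> oU sf [s1 s2]; split; exact: sectionZ. Qed.

Lemma ssection_sum U (I : Type) (r : seq I) (P : pred I) (s : I -> forall q, fib q) :
  open U -> (forall i, P i -> smooth_ssection U (s i)) ->
  smooth_ssection U (fun q => \sum_(i <- r | P i) s i q).
Proof.
move=> oU ss; elim: r => [|i r IH].
  by apply: ssection_eq (ssection0 oU) => // q _; rewrite big_nil.
case Pi: (P i).
  apply: (ssection_eq oU _ (ssectionD oU (ss i Pi) IH)) => q _.
  by rewrite big_cons Pi.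
by apply: (ssection_eq oU _ IH) => q _; rewrite big_cons Pi.
Qed.

Lemma ssection_vpart U b s : open U -> smooth_ssection U s ->
  smooth_ssection U (fun q => vpart b (s q)).
Proof.
by move=> oU [s1 s2]; case: b; split => //; exact: section0.
Qed.

Definition sfdom (p : M) : set M := fdom (even_bundle E) p `&` fdom (odd_bundle E) p.

Definition sindex (p : M) : finType :=
  ('I_(frank (even_bundle E) p) + 'I_(frank (odd_bundle E) p))%type.

Definition sframe (p : M) (i : sindex p) (q : M) : fib q :=
  match i with
  | inl a => (tnth (frame (even_bundle E) p q) a, 0)
  | inr a => (0, tnth (frame (odd_bundle E) p q) a)
  end.

Definition scoord (p : M) (i : sindex p) (q : M) (w : fib q) : R :=
  match i with
  | inl a => coord (frame (even_bundle E) p q) a w.1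
  | inr a => coord (frame (odd_bundle E) p q) a w.2
  end.

Lemma sfdom_open p : open (sfdom p).
Proof. by apply: openI; exact: fdom_open. Qed.

Lemma sfdom_center p : sfdom p p.
Proof. by split; exact: fdom_center. Qed.

Lemma scoord_linear p (i : sindex p) q (a : R) (w w' : fib q) :
  scoord i (a *: w + w') = a * scoord i w + scoord i w'.
Proof. by case: i => i; rewrite /scoord /= linearP. Qed.

Lemma sframe_expand p q (w : fib q) : sfdom p q ->
  w = \sum_(i : sindex p) scoord i w *: sframe i q.
Proof.
case: w => w1 w2 [p1 p2]; rewrite big_sumType /=.
have e1 := coord_basis (frame_basis p1) (memvf w1).
have e2 := coord_basis (frame_basis p2) (memvf w2).
have -> : (w1, w2) = (w1, 0) + (0, w2) :> fib q.
  by congr pair; rewrite /= ?addr0 ?add0r.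
congr (_ + _); [rewrite {1}e1|rewrite {1}e2].
  rewrite pair_sum_l.
  by apply: eq_bigr => i _; rewrite (tnth_nth 0).
rewrite pair_sum_r.
by apply: eq_bigr => i _; rewrite (tnth_nth 0).
Qed.

Lemma ssection_sframe p (i : sindex p) : smooth_ssection (sfdom p) (@sframe p i).
Proof.
have o := sfdom_open p.
case: i => a; split => /=; try exact: section0.
  exact: (section_sub (@subIsetl _ _ _) (section_frame a)).
exact: (section_sub (@subIsetr _ _ _) (section_frame a)).
Qed.

Lemma smooth_scoord U s p (i : sindex p) : smooth_ssection U s ->
  smooth_fun (U `&` sfdom p) (fun q => scoord i (s q)).
Proof.
move=> [s1 s2]; case: i => a.
  by apply: smooth_fun_sub (s1 p a) => q [? []].
by apply: smooth_fun_sub (s2 p a) => q [? []].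
Qed.

(** Smoothness of an endomorphism is stated on the columns in the frames of the even
    and odd parts; by expansion in these frames it is equivalent to preserving smooth
    sections over all smaller open sets. *)
Lemma esectionP U (L : forall q, 'End(fib q)) : open U ->
  smooth_esection U L <->
  (forall V s, V `<=` U -> open V -> smooth_ssection V s ->
     smooth_ssection V (fun q => L q (s q))).
Proof.
move=> oU; split=> [[L1 L2] V s VU oV ss|H]; last first.
  split=> p a; apply: H => //; try (by apply: openI => //; exact: fdom_open).
    have o : open (U `&` fdom (even_bundle E) p) by exact: open_fdomI.
    by split; [exact: section_sub (@subIsetr _ _ _) (section_frame a)|exact: section0].
  have o : open (U `&` fdom (odd_bundle E) p) by exact: open_fdomI.
  by split; [exact: section0|exact: section_sub (@subIsetr _ _ _) (section_frame a)].
apply: ssection_local => q0 Vq0; exists (V `&` sfdom q0).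
  by split=> //; exact: sfdom_center.
have o : open (V `&` sfdom q0) by apply: openI => //; exact: sfdom_open.
have sL i : smooth_ssection (V `&` sfdom q0) (fun q => L q (@sframe q0 i q)).
  case: i => a; [apply: ssection_sub (L1 q0 a)|apply: ssection_sub (L2 q0 a)].
    by move=> q [/VU ? []].
  by move=> q [/VU ? []].
have S : smooth_ssection (V `&` sfdom q0)
    (fun q => \sum_(i : sindex q0) scoord i (s q) *: L q (@sframe q0 i q)).
  by apply: ssection_sum => // i _; apply: ssectionZ => //; exact: smooth_scoord.
apply: ssection_eq S => // q [Vq q0q].
rewrite [in RHS](sframe_expand (s q) q0q) linear_sum.
by apply: eq_bigr => i _; rewrite linearZ.
Qed.

(** Multiply by a bump function supported in [V]. *)
Lemma smooth_extend V (f : M -> R) q0 : open V -> V q0 -> smooth_fun V f ->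
  exists g : M -> R, exists V0, [/\ smooth_fun setT g, open V0, V0 q0, V0 `<=` V &
    forall q, V0 q -> g q = f q].
Proof.
move=> oV Vq0 sf; have [chi [V0 [W [sc [oV0 V0q V0V c1] [oW VW c0]]]]] := exists_bump oV Vq0.
exists (fun q => chi q * f q), V0; split=> //; last by move=> q /c1 ->; rewrite mul1r.
apply: smooth_fun_local => q _; case: (VW q) => Hq.
  by exists V => //; apply: smooth_funM => //; exact: smooth_fun_sub sc.
exists W => //; apply: (smooth_fun_eq oW _ (smooth_fun_cst 0 oW)) => z /c0 ->.
by rewrite mul0r.
Qed.

Lemma ssection_extend V s q0 : open V -> V q0 -> smooth_ssection V s ->
  exists s' : forall q, fib q, exists V0, [/\ smooth_ssection setT s', open V0, V0 q0, V0 `<=` V &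
    forall q, V0 q -> s' q = s q].
Proof.
move=> oV Vq0 ss; have [chi [V0 [W [sc [oV0 V0q V0V c1] [oW VW c0]]]]] := exists_bump oV Vq0.
exists (fun q => chi q *: s q), V0; split=> //; last by move=> q /c1 ->; rewrite scale1r.
apply: ssection_local => q _; case: (VW q) => Hq.
  by exists V => //; apply: ssectionZ => //; exact: smooth_fun_sub sc.
exists W => //; apply: (ssection_eq oW _ (ssection0 oW)) => z /c0 ->.
by rewrite scale0r.
Qed.

End SBundle.
End Sections.

(** * Parity, and forms with values in a superbundle *)

Section ShuffleMore.
Context {R : realType} {n : nat}.
Local Notation T := 'rV[R]_n.

Lemma shuffle_homog0l (U V W : lmodType R) (op : U -> V -> W)
    (f : seq T -> U) (g : seq T -> V) vs :
  bilin op -> homog 0 f -> shuffle op f g vs = op (f [::]) (g vs).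
Proof.
move=> bop; elim: vs f g => [//|v vs IH] f g hf /=.
rewrite ins_homog0 // shuffle0l // add0r IH; last first.
  by move=> t /hf ft; rewrite /sgn_deg ft scaler0.
by rewrite /sgn_deg muln0 expr0 scale1r.
Qed.

Lemma shuffle_homog0r (U V W : lmodType R) (op : U -> V -> W)
    (f : seq T -> U) (g : seq T -> V) vs :
  bilin op -> homog 0 g -> shuffle op f g vs = op (f vs) (g [::]).
Proof.
move=> bop; elim: vs f g => [//|v vs IH] f g hg /=.
by rewrite (ins_homog0 v hg) shuffle0r // addr0 IH.
Qed.

(** Smoothness passes through the recursion defining [shuffle] because it is
    assumed for all argument lists at once.  The predicates are abstract so that the
    same proof serves for scalar-, bundle- and endomorphism-valued forms. *)
Lemma shuffle_smooth (X : Type) (U V W : X -> lmodType R)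
    (op : forall q, U q -> V q -> W q) (cv : X -> T -> T)
    (sU : (forall q, U q) -> Prop) (sV : (forall q, V q) -> Prop)
    (sW : (forall q, W q) -> Prop) :
  (forall a b, sU a -> sV b -> sW (fun q => op q (a q) (b q))) ->
  (forall a b, sW a -> sW b -> sW (fun q => a q + b q)) ->
  (forall (c : R) a, sU a -> sU (fun q => c *: a q)) ->
  forall (f : forall q, seq T -> U q) (g : forall q, seq T -> V q),
  (forall vs, sU (fun q => f q (map (cv q) vs))) ->
  (forall vs, sV (fun q => g q (map (cv q) vs))) ->
  forall vs, sW (fun q => shuffle (op q) (f q) (g q) (map (cv q) vs)).
Proof.
move=> sop sD sZ f g sf sg vs; elim: vs f g sf sg => [|v vs IH] f g sf sg /=.
  by apply: sop; [exact: (sf [::])|exact: (sg [::])].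
apply: sD.
  by apply: (IH (fun q => ins (cv q v) (f q))) => // ws; exact: (sf (v :: ws)).
apply: (IH (fun q => sgn_deg 1 (f q)) (fun q => ins (cv q v) (g q))) => // ws; last first.
  exact: (sg (v :: ws)).
have := sZ ((-1) ^+ (1 * size ws)) _ (sf ws).
congr sU; apply: functional_extensionality_dep => q.
by rewrite /sgn_deg size_map.
Qed.

End ShuffleMore.

Section Parity.
Context {R : realType} {n : nat} {M : smoothManifold R n}.
Variable E : superbundle M.
Local Notation fib := (sfiber E).

Lemma vpart_lin b p (a : R) (w w' : fib p) :
  vpart b (a *: w + w') = a *: vpart b w + vpart b w'.
Proof. by case: b; congr pair; rewrite /= ?scaler0 ?addr0. Qed.

Lemma vprojE b p (w : fib p) : vproj E b p w = vpart b w.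
Proof.
pose lin := GRing.isLinear.Build R (fib p) (fib p) _ (@vpart R n M E b p)
  (fun a u v => vpart_lin b a u v).
pose L : {linear fib p -> fib p} := HB.pack (@vpart R n M E b p) lin.
by rewrite /vproj -[vpart b w]/(L w) -(lfunE L).
Qed.

Lemma vpart0 b p : vpart b (0 : fib p) = 0.
Proof. by rewrite -vprojE linear0. Qed.

Lemma vpartD b p (w w' : fib p) : vpart b (w + w') = vpart b w + vpart b w'.
Proof. by rewrite -!vprojE linearD. Qed.

Lemma vpartZ b p a (w : fib p) : vpart b (a *: w) = a *: vpart b w.
Proof. by rewrite -!vprojE linearZ. Qed.

Lemma vpart_vpart b c p (w : fib p) :
  vpart b (vpart c w) = if b == c then vpart c w else 0.
Proof. by case: b c => [] []. Qed.

Lemma vpart_sum p (w : fib p) : \sum_(b : bool) vpart b w = w.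
Proof.
rewrite big_bool; case: w => w1 w2.
by congr pair; rewrite /= ?addr0 ?add0r.
Qed.

Lemma epartE c p (L : 'End(fib p)) w :
  epart c L w = \sum_(b : bool) vpart (b (+) c) (L (vpart b w)).
Proof.
rewrite /epart sum_lfunE; apply: eq_bigr => b _.
by rewrite !comp_lfunE !vprojE.
Qed.

Lemma epart_vpart c p (L : 'End(fib p)) b w :
  epart c L (vpart b w) = vpart (b (+) c) (L (vpart b w)).
Proof.
rewrite epartE big_bool !vpart_vpart; case: b => /=.
  by rewrite linear0 vpart0 addr0.
by rewrite linear0 vpart0 add0r.
Qed.

Lemma epart_lin c p (a : R) (L L' : 'End(fib p)) :
  epart c (a *: L + L') = a *: epart c L + epart c L'.
Proof.
apply/lfunP => w; rewrite add_lfunE scale_lfunE !epartE scaler_sumr -big_split.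
by apply: eq_bigr => b _; rewrite add_lfunE scale_lfunE vpart_lin.
Qed.

Lemma epart0 c p : epart c (0 : 'End(fib p)) = 0.
Proof.
have := epart_lin c (-1) (0 : 'End(fib p)) 0.
by rewrite scaler0 addr0 scaleN1r addNr.
Qed.

Lemma epartZ c p a (L : 'End(fib p)) : epart c (a *: L) = a *: epart c L.
Proof. by have := epart_lin c a L 0; rewrite epart0 !addr0. Qed.

Lemma epart_sum p (L : 'End(fib p)) : \sum_(c : bool) epart c L = L.
Proof.
apply/lfunP => w; rewrite sum_lfunE -[in RHS](vpart_sum w) linear_sum.
under eq_bigr do rewrite epartE.
rewrite exchange_big; apply: eq_bigr => b _ /=.
rewrite -[RHS]vpart_sum !big_bool; case: b => //=; exact: addrC.
Qed.

Lemma epart_epart c d p (L : 'End(fib p)) :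
  epart c (epart d L) = if c == d then epart d L else 0.
Proof.
apply/lfunP => w; rewrite epartE.
under eq_bigr do rewrite epart_vpart vpart_vpart.
case: eqVneq => [->|cd]; first by rewrite epartE; apply: eq_bigr => b _; rewrite eqxx.
by rewrite zero_lfunE; apply: big1 => b _; case: b c d cd => [] [] [].
Qed.

Lemma epart_fix c p (L : 'End(fib p)) b w :
  epart c L = L -> L (vpart b w) = vpart (b (+) c) (L (vpart b w)).
Proof. by move=> <-; rewrite epart_vpart vpart_vpart eqxx. Qed.

Lemma epart_fixP c p (L : 'End(fib p)) :
  (forall b w, vpart (b (+) c) (L (vpart b w)) = L (vpart b w)) -> epart c L = L.
Proof.
move=> H; apply/lfunP => w; rewrite epartE -[in RHS](vpart_sum w) linear_sum.
by apply: eq_bigr => b _; rewrite H.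
Qed.

End Parity.

Section Forms.
Context {R : realType} {n : nat} {M : smoothManifold R n}.
Variable E : superbundle M.
Local Notation fib := (sfiber E).
Local Notation T := 'rV[R]_n.
Implicit Types (eta zeta : eform E) (F G : endform E) (alpha beta : sform M).

Definition scop {V : lmodType R} (a : R^o) (w : V) : V := (a : R) *: w.
Definition appop {p : M} (L : 'End(fib p)) (w : fib p) : fib p := L w.

Lemma bilin_scop (V : lmodType R) : bilin (@scop V).
Proof.
split=> [a x x' y|a x y y']; rewrite /scop.
  by rewrite scalerDl scalerA.
by rewrite scalerDr !scalerA mulrC.
Qed.

Lemma bilin_appop p : bilin (@appop p).
Proof.
split=> [a x x' y|a x y y']; rewrite /appop; last by rewrite linearP.
by rewrite add_lfunE scale_lfunE.
Qed.

Lemma wedgeE (W : M -> lmodType R) alpha (eta : pform W) p vs :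
  wedge alpha eta p vs = shuffle scop (alpha p) (eta p) vs.
Proof. by rewrite (shuffle_sum (bilin_scop _)). Qed.

Definition Fpart F c p : seq T -> 'End(fib p) := fun t => epart c (F p t).

(** The sign rule of the action is graded by the parity of the endomorphism, so the
    action is a sum of one shuffle product for each parity. *)
Lemma actE F eta p vs :
  act F eta p vs = \sum_(c : bool) shuffle appop (Fpart F c p) (sgn_deg c (eta p)) vs.
Proof.
rewrite /act; under [RHS]eq_bigr do rewrite (shuffle_sum (bilin_appop _)).
rewrite exchange_big /=; apply: eq_bigr => m _.
rewrite scaler_sumr; apply: eq_bigr => c _.
by rewrite /appop /Fpart /sgn_deg; congr (_ *: _); rewrite linearZ.
Qed.

Lemma formP (eta zeta : eform E) : (forall p vs, eta p vs = zeta p vs) -> eta = zeta.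
Proof. exact: pformP. Qed.

Lemma tpart_lin b (a : R) eta zeta :
  tpart b (a *: eta + zeta) = a *: tpart b eta + tpart b zeta.
Proof. by apply: formP => p vs; apply: vpart_lin. Qed.

Lemma tpart_sum eta : \sum_(b : bool) tpart b eta = eta.
Proof.
apply: formP => p vs; rewrite big_bool -[RHS]vpart_sum big_bool.
rewrite -[LHS]/(tpart true eta p vs + tpart false eta p vs) /tpart.
by case: (odd (size vs)); rewrite //= addrC.
Qed.

Lemma tpart_tpart b c eta : tpart b (tpart c eta) = if b == c then tpart c eta else 0.
Proof.
apply: formP => p vs; rewrite /tpart vpart_vpart.
by rewrite (inj_eq (@addIb _)); case: ifP.
Qed.

Lemma Omega_lin (a : R) eta zeta : Omega eta -> Omega zeta -> Omega (a *: eta + zeta).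
Proof.
move=> [m1 s1] [m2 s2]; split=> [p|p vs].
  split=> [s t b u v|s t r u].
    have [f1 _] := m1 p; have [f2 _] := m2 p.
    rewrite -[LHS]/(a *: eta p _ + zeta p _) f1 f2.
    rewrite -[X in _ = b *: X + _]/(a *: eta p _ + zeta p _).
    rewrite -[X in _ = _ + X]/(a *: eta p _ + zeta p _).
    by rewrite !scalerDr !scalerA addrACA mulrC.
  have [_ f1] := m1 p; have [_ f2] := m2 p.
  by rewrite -[LHS]/(a *: eta p _ + zeta p _) f1 f2 scaler0 addr0.
have o := @cdom_open _ _ M p.
apply: (ssectionD o _ (s2 p vs)); apply: (ssectionZ o _ (s1 p vs)); exact: smooth_fun_cst.
Qed.

Lemma Omega0 : Omega (0 : eform E).
Proof.
split=> [p|p vs]; last by apply: ssection0; exact: cdom_open.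
by split=> [s t b u v|s t r u] //; rewrite -[LHS]/0 -[RHS]/(b *: 0 + 0) scaler0 addr0.
Qed.

Lemma OmegaD eta zeta : Omega eta -> Omega zeta -> Omega (eta + zeta).
Proof. by move=> h1 h2; have := Omega_lin 1 h1 h2; rewrite scale1r. Qed.

Lemma OmegaZ (a : R) eta : Omega eta -> Omega (a *: eta).
Proof. by move=> h1; have := Omega_lin a h1 Omega0; rewrite addr0. Qed.

Lemma OmegaN eta : Omega eta -> Omega (- eta).
Proof. by move=> h1; rewrite -scaleN1r; exact: OmegaZ. Qed.

Lemma OmegaB eta zeta : Omega eta -> Omega zeta -> Omega (eta - zeta).
Proof. by move=> h1 h2; apply: OmegaD => //; exact: OmegaN. Qed.

Lemma Omega_sum (I : Type) (r : seq I) (P : pred I) (F : I -> eform E) :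
  (forall i, P i -> Omega (F i)) -> Omega (\sum_(i <- r | P i) F i).
Proof. move=> H; apply: big_ind H; [exact: Omega0|exact: OmegaD]. Qed.

Lemma Omega_tpart b eta : Omega eta -> Omega (tpart b eta).
Proof.
move=> [m1 s1]; split=> [p|p vs].
  have [f1 f2] := m1 p; split=> [s t a u v|s t r u].
    by rewrite /tpart f1 vpart_lin !size_cat.
  by rewrite /tpart f2 vpart0.
have o := @cdom_open _ _ M p.
apply: (ssection_eq o _ (ssection_vpart (b (+) odd (size vs)) o (s1 p vs))) => q _.
by rewrite /tpart size_map.
Qed.

Lemma Omega_wedge alpha eta : Omega_scalar alpha -> Omega eta -> Omega (wedge alpha eta).
Proof.
move=> [m1 s1] [m2 s2]; split=> [p|p vs].
  have [a1 a2] := m1 p; have [f1 f2] := m2 p.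
  have -> : wedge alpha eta p = shuffle scop (alpha p) (eta p).
    by apply/funext => vs; exact: wedgeE.
  split; [exact: multilinear_shuffle (bilin_scop _) _ _ a1 f1|].
  exact: alternating_shuffle (bilin_scop _) _ _ a1 a2 f1 f2.
have o := @cdom_open _ _ M p.
have := @shuffle_smooth R n M (fun=> R^o) fib fib (fun q => scop) (coordvec p)
  (smooth_fun (cdom p)) (smooth_ssection (cdom p)) (smooth_ssection (cdom p)).
move=> /(_ (fun a b sa sb => ssectionZ o sa sb)).
move=> /(_ (fun a b sa sb => ssectionD o sa sb)).
move=> /(_ (fun c a sa => smooth_funM o (smooth_fun_cst c o) sa)).
move=> /(_ alpha eta (s1 p) (s2 p) vs) H.
by apply: (ssection_eq o _ H) => q _; rewrite wedgeE.
Qed.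

Lemma Fpart_esection F c p vs : OmegaEnd F ->
  smooth_esection (cdom p) (fun q => Fpart F c q (map (coordvec p q) vs)).
Proof.
move=> [_ sF]; have o := @cdom_open _ _ M p.
have /(esectionP _ o) sFp := sF p vs.
apply/(esectionP _ o) => V s Vo oV ss.
have S : smooth_ssection V (fun q => \sum_(b : bool)
    vpart (b (+) c) (F q (map (coordvec p q) vs) (vpart b (s q)))).
  apply: ssection_sum => // b _; apply: ssection_vpart => //.
  by apply: sFp => //; exact: ssection_vpart.
by apply: (ssection_eq oV _ S) => q _; rewrite /Fpart epartE.
Qed.

Lemma Omega_act F eta : OmegaEnd F -> Omega eta -> Omega (act F eta).
Proof.
move=> OF [m2 s2]; have [m1 s1] := OF.
have E1 p : act F eta p = (fun vs => \sum_(c : bool) shuffle appop (Fpart F c p) (sgn_deg c (eta p)) vs).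
  by apply/funext => vs; exact: actE.
have mF c p : multilinear (Fpart F c p).
  by move=> s t a u v; rewrite /Fpart (m1 p).1 epart_lin.
have aF c p : Defs.alternating (Fpart F c p).
  by move=> s t r u; rewrite /Fpart (m1 p).2 epart0.
split=> [p|p vs].
  have [f1 f2] := m2 p; rewrite E1; split=> [s t a u v|s t r u].
    rewrite scaler_sumr -big_split; apply: eq_bigr => c _ /=.
    by apply: multilinear_shuffle (bilin_appop _) _ _ (mF c p) _ _ _ _ _ _; exact: multilinear_sgn.
  rewrite big1 // => c _.
  by apply: alternating_shuffle (bilin_appop _) _ _ (mF c p) (aF c p) _ _ _ _ _ _;
    [exact: multilinear_sgn|exact: alternating_sgn].
have o := @cdom_open _ _ M p.
have H (c : bool) : smooth_ssection (cdom p)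
    (fun q => shuffle appop (Fpart F c q) (sgn_deg c (eta q)) (map (coordvec p q) vs)).
  have := @shuffle_smooth R n M (fun q => 'End(fib q)) fib fib (fun q => @appop q) (coordvec p)
    (smooth_esection (cdom p)) (smooth_ssection (cdom p)) (smooth_ssection (cdom p)).
  apply=> //.
  - by move=> a b /(esectionP _ o) sa sb; exact: sa.
  - by move=> a b sa sb; exact: ssectionD.
  - move=> k a /(esectionP _ o) sa; apply/(esectionP _ o) => V s Vo oV ss.
    apply: (ssection_eq oV _ (ssectionZ oV (smooth_fun_cst k oV) (sa V s Vo oV ss))) => q _.
    by rewrite scale_lfunE.
  - by move=> ws; exact: Fpart_esection.
  - move=> ws; apply: (ssection_eq o _ (ssectionZ o (smooth_fun_cst ((-1) ^+ (c * size ws)) o) (s2 p ws))) => q _.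
    by rewrite /sgn_deg size_map.
have S : smooth_ssection (cdom p) (fun q => \sum_(c : bool)
    shuffle appop (Fpart F c q) (sgn_deg c (eta q)) (map (coordvec p q) vs)).
  by apply: ssection_sum => // c _; exact: H.
by apply: (ssection_eq o _ S) => q _; rewrite E1.
Qed.

End Forms.
Arguments bilin_appop {R n M E} p.
Arguments bilin_scop {R} V.
Arguments vpartD {R n M E} b {p}.
Arguments vpart0 {R n M E} b p.
Arguments appop {R n M E p} L w.

(** * The action of endomorphism-valued forms *)

Section ActAlgebra.
Context {R : realType} {n : nat} {M : smoothManifold R n}.
Variable E : superbundle M.
Local Notation fib := (sfiber E).
Local Notation T := 'rV[R]_n.
Implicit Types (eta zeta : eform E) (F G : endform E) (alpha beta : sform M).

Lemma act_linr F (a : R) eta zeta :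
  act F (a *: eta + zeta) = a *: act F eta + act F zeta.
Proof.
apply: formP => p vs; rewrite -[RHS]/(a *: act F eta p vs + act F zeta p vs) !actE.
rewrite scaler_sumr -big_split; apply: eq_bigr => c _ /=.
have -> : sgn_deg c ((a *: eta + zeta) p) =
    (fun t => a *: sgn_deg c (eta p) t + sgn_deg c (zeta p) t) by exact: sgn_lin.
by rewrite (shuffle_linr (bilin_appop _)).
Qed.

Lemma act0r F : act F 0 = 0.
Proof. by have := act_linr F (-1) 0 0; rewrite scaler0 addr0 scaleN1r addNr. Qed.

Lemma actDr F eta zeta : act F (eta + zeta) = act F eta + act F zeta.
Proof. by have := act_linr F 1 eta zeta; rewrite !scale1r. Qed.

Lemma actZr F a eta : act F (a *: eta) = a *: act F eta.
Proof. by have := act_linr F a eta 0; rewrite act0r !addr0. Qed.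

Lemma act_linl F G (a : R) eta : act (a *: F + G) eta = a *: act F eta + act G eta.
Proof.
apply: formP => p vs; rewrite -[RHS]/(a *: act F eta p vs + act G eta p vs) !actE.
rewrite scaler_sumr -big_split; apply: eq_bigr => c _ /=.
have -> : Fpart (a *: F + G) c p = (fun t => a *: Fpart F c p t + Fpart G c p t).
  by apply/funext => t; exact: epart_lin.
by rewrite (shuffle_linl (bilin_appop _)).
Qed.

Lemma act0l eta : act (0 : endform E) eta = 0.
Proof. by have := act_linl 0 0 (-1) eta; rewrite scaler0 addr0 scaleN1r addNr. Qed.

Lemma actDl F G eta : act (F + G) eta = act F eta + act G eta.
Proof. by have := act_linl F G 1 eta; rewrite !scale1r. Qed.

Lemma etpart_sum F : \sum_(b : bool) etpart b F = F.
Proof.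
rewrite big_bool; apply: pformP => p vs.
rewrite -[LHS]/(etpart true F p vs + etpart false F p vs) -[RHS]epart_sum big_bool /etpart.
by case: (odd (size vs)); rewrite //= addrC.
Qed.

Lemma etpart_etpart b c F : etpart b (etpart c F) = if b == c then etpart c F else 0.
Proof.
apply: pformP => p vs; rewrite /etpart epart_epart (inj_eq (@addIb _)).
by case: ifP.
Qed.

Lemma etpart_id b F : etpart b (etpart b F) = etpart b F.
Proof. by rewrite etpart_etpart eqxx. Qed.

(** Parities add up: the total degree is the parity of the value plus the number of
    arguments, and every argument goes to exactly one factor. *)
Lemma shuffle_vpart p (f : seq T -> 'End(fib p)) (g : seq T -> fib p) b c vs :
  (forall t, epart (b (+) odd (size t)) (f t) = f t) ->
  (forall t, vpart (c (+) odd (size t)) (g t) = g t) ->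
  vpart (c (+) b (+) odd (size vs)) (shuffle appop f g vs) = shuffle appop f g vs.
Proof.
elim: vs f g b c => [|v vs IH] f g b c hf hg.
  rewrite /= /appop addbF -(hg [::]) (epart_fix _ _ (hf [::])) /= !addbF.
  by rewrite vpart_vpart eqxx.
rewrite /= vpartD; congr (_ + _).
  rewrite -[RHS](IH _ _ (~~ b) c) //; last by move=> t; rewrite /ins -[in RHS](hf (v :: t)) /= addNb addbN.
  by rewrite addbN addbN addNb.
rewrite -[RHS](IH _ _ b (~~ c)).
- by rewrite addbN !addNb.
- by move=> t; rewrite /sgn_deg epartZ hf.
- by move=> t; rewrite /ins -[in RHS](hg (v :: t)) /= addNb addbN.
Qed.

Lemma act_tpart F b c eta : etpart b F = F -> tpart c eta = eta ->
  tpart (c (+) b) (act F eta) = act F eta.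
Proof.
move=> hF he; apply: formP => p vs; rewrite /tpart actE.
rewrite (big_morph _ (vpartD _) (vpart0 _ _)).
apply: eq_bigr => d _; apply: shuffle_vpart => t.
  rewrite /Fpart; have -> : F p t = epart (b (+) odd (size t)) (F p t) by rewrite -{1}hF.
  rewrite (epart_epart d); case: ifP => _; last exact: epart0.
  by rewrite epart_epart eqxx.
by rewrite /sgn_deg vpartZ -{2}he.
Qed.

(** Move [beta] past the endomorphism-valued factor.  The component of [F] of form
    degree d has endomorphism parity b + d; the action contributes the sign of b + d
    and the graded commutativity the sign of d, so b remains. *)
Lemma act_wedge F b k beta eta : etpart b F = F -> has_degree k beta ->
  act F (wedge beta eta) = (-1) ^+ (k * b) *: wedge beta (act F eta).
Proof.
move=> hF hb; apply: formP => p vs.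
rewrite -[RHS]/((-1) ^+ (k * b) *: wedge beta (act F eta) p vs).
have hh : homog k (beta p) by move=> t; exact: hb.
pose flips (L : 'End(fib p)) (a : R^o) : 'End(fib p) := scop a L.
have bf : bilin flips.
  by split=> [a x x' y|a x y y']; rewrite /flips ?(bilinr (bilin_scop _)) ?(bilinl (bilin_scop _)).
rewrite wedgeE actE.
have -> : act F eta p = (fun t => 1 *: shuffle appop (Fpart F true p) (sgn_deg true (eta p)) t +
    shuffle appop (Fpart F false p) (sgn_deg false (eta p)) t).
  by apply/funext => t; rewrite actE big_bool scale1r.
rewrite (shuffle_linr (bilin_scop _)) scale1r scalerDr big_bool.
have H (c : bool) : shuffle appop (Fpart F c p) (sgn_deg c (wedge beta eta p)) vs =
    (-1) ^+ (k * b) *: shuffle scop (beta p) (shuffle appop (Fpart F c p) (sgn_deg c (eta p))) vs.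
  have -> : sgn_deg c (wedge beta eta p) = shuffle scop (sgn_deg c (beta p)) (sgn_deg c (eta p)).
    apply/funext => t; rewrite (shuffle_sgn (bilin_scop _)).
    by congr (sgn_deg _ _ _); apply/funext => t'; rewrite wedgeE.
  have hg : homog k (sgn_deg c (beta p)) by move=> t /hh ft; rewrite /sgn_deg ft scaler0.
  rewrite (shuffle_assoc (op1 := flips) (op2 := appop) _ _ _ _ bf (bilin_appop _) (bilin_scop _) (bilin_appop _));
    last by move=> x y z; rewrite /appop /flips /scop linearZ scale_lfunE.
  have -> : shuffle flips (Fpart F c p) (sgn_deg c (beta p)) =
      shuffle scop (sgn_deg c (beta p)) (sgn_deg k (Fpart F c p)).
    by apply/funext => t; apply: shuffle_swap hg => //; exact: bilin_scop.
  rewrite -(shuffle_assoc (op3 := appop) (op4 := scop) _ _ _ _ (bilin_scop _) (bilin_appop _) (bilin_appop _) (bilin_scop _));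
    last by move=> x y z; rewrite /appop /scop scale_lfunE.
  have -> : sgn_deg k (Fpart F c p) = (fun t => (-1) ^+ (k * (b (+) c)) *: Fpart F c p t).
    apply/funext => t; rewrite /sgn_deg /Fpart -hF /etpart epart_epart.
    case: eqVneq => [->|_]; last by rewrite !scaler0.
    by rewrite addbA addbb addFb ![(k * _)%N]mulnC !exprM signr_odd.
  have -> : shuffle appop (fun t => (-1) ^+ (k * (b (+) c)) *: Fpart F c p t) (sgn_deg c (eta p)) =
      (fun t => (-1) ^+ (k * (b (+) c)) *: shuffle appop (Fpart F c p) (sgn_deg c (eta p)) t).
    by apply/funext => t; rewrite (shuffleZl (bilin_appop _)).
  rewrite (shuffleZr (bilin_scop _)) (sgn_homog c hh) (shuffleZl (bilin_scop _)) scalerA.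
  congr (_ *: _); case: c {hg}; case: b hF => hF; rewrite /= ?muln0 ?muln1 ?mul1n ?mul0n ?mulr1 ?mul1r //.
  by rewrite -exprMn mulrNN mulr1 expr1n.
by rewrite !H.
Qed.

Lemma wedge_linr alpha (a : R) eta zeta :
  wedge alpha (a *: eta + zeta) = a *: wedge alpha eta + wedge alpha zeta.
Proof.
apply: formP => p vs; rewrite -[RHS]/(a *: wedge alpha eta p vs + wedge alpha zeta p vs) !wedgeE.
by rewrite (shuffle_linr (bilin_scop _)).
Qed.

Lemma wedge0r alpha : wedge alpha (0 : eform E) = 0.
Proof. by have := wedge_linr alpha (-1) 0 0; rewrite scaler0 addr0 scaleN1r addNr. Qed.

Lemma wedgeDr alpha eta zeta : wedge alpha (eta + zeta) = wedge alpha eta + wedge alpha zeta.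
Proof. by have := wedge_linr alpha 1 eta zeta; rewrite !scale1r. Qed.

Lemma wedgeZr alpha a eta : wedge alpha (a *: eta) = a *: wedge alpha eta.
Proof. by have := wedge_linr alpha a eta 0; rewrite wedge0r !addr0. Qed.

Lemma wedge0l eta : wedge (0 : sform M) eta = 0.
Proof.
apply: formP => p vs; rewrite wedgeE.
exact: (shuffle0l (bilin_scop _)).
Qed.

Lemma wedgeC k l alpha beta eta : has_degree k alpha -> has_degree l beta ->
  wedge alpha (wedge beta eta) = (-1) ^+ (k * l) *: wedge beta (wedge alpha eta).
Proof.
move=> ha hb; apply: formP => p vs.
rewrite -[RHS]/((-1) ^+ (k * l) *: wedge beta (wedge alpha eta) p vs) !wedgeE.
have ha' : homog k (alpha p) by move=> t; exact: ha.
have hb' : homog l (beta p) by move=> t; exact: hb.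
pose mul (a b : R^o) : R^o := (a : R) * (b : R).
have bm : bilin mul.
  split=> [a x x' y|a x y y']; rewrite /mul; first by rewrite mulrDl -mulrA.
  by rewrite mulrDr [in LHS]/GRing.scale /= mulrCA.
have wE a : wedge a eta p = shuffle scop (a p) (eta p) by apply/funext => t; exact: wedgeE.
have A (a b : sform M) : shuffle scop (a p) (shuffle scop (b p) (eta p)) vs =
    shuffle scop (shuffle mul (a p) (b p)) (eta p) vs.
  apply: shuffle_assoc => //; try exact: bilin_scop.
  by move=> x y z; rewrite /scop scalerA.
rewrite !wE !A.
have -> : shuffle mul (alpha p) (beta p) =
    (fun t => (-1) ^+ (k * l) *: shuffle mul (beta p) (alpha p) t).
  apply/funext => t.
  rewrite (@shuffle_swap R n _ _ _ mul mul l _ _ t bm bm _ hb'); last first.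
    by move=> x y; rewrite /mul mulrC.
  by rewrite (sgn_homog l ha') shuffleZr // mulnC.
by rewrite (shuffleZl (bilin_scop _)).
Qed.

Lemma shuffle_scop_vpart p (f : seq T -> R^o) (g : seq T -> fib p) (b c : bool) vs :
  (forall t, odd (size t) != b -> f t = 0) ->
  (forall t, vpart (c (+) odd (size t)) (g t) = g t) ->
  vpart (c (+) b (+) odd (size vs)) (shuffle scop f g vs) = shuffle scop f g vs.
Proof.
elim: vs f g b c => [|v vs IH] f g b c hf hg.
  rewrite /= /scop addbF vpartZ; case: b hf => [->//|_]; first by rewrite !scale0r.
  by rewrite -{2}(hg [::]).
rewrite /= vpartD; congr (_ + _).
  rewrite -[RHS](IH _ _ (~~ b) c) //; last by move=> t ht; apply: hf; rewrite /= -[b]negbK (inj_eq negb_inj).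
  by rewrite addbN addbN addNb.
rewrite -[RHS](IH _ _ b (~~ c)).
- by rewrite addbN !addNb.
- by move=> t /hf ft; rewrite /sgn_deg ft scaler0.
- by move=> t; rewrite /ins -[in RHS](hg (v :: t)) /= addNb addbN.
Qed.

Lemma wedge_tpart k c alpha eta : has_degree k alpha -> tpart c eta = eta ->
  tpart (c (+) odd k) (wedge alpha eta) = wedge alpha eta.
Proof.
move=> ha he; apply: formP => p vs; rewrite /tpart wedgeE.
apply: shuffle_scop_vpart => t; last by rewrite -{2}he.
by move=> st; apply: ha; apply: contraNneq st => ->.
Qed.

(** The block from parity [c] to parity [b] only sees the component of total parity
    [b + c]. *)
Lemma act_block F b c eta :
  block (act F) b c eta = act (etpart (b (+) c) F) (tpart c eta).
Proof.
rewrite /block -{1}(etpart_sum F) big_bool actDl.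
have H d : act (etpart d F) (tpart c eta) =
    tpart (c (+) d) (act (etpart d F) (tpart c eta)).
  by rewrite act_tpart ?etpart_id // tpart_tpart eqxx.
have := tpart_lin b 1 (act (etpart true F) (tpart c eta)) (act (etpart false F) (tpart c eta)).
rewrite !scale1r => ->.
rewrite H (H false) !tpart_tpart.
by case: b; case: c H => H; rewrite [RHS]H /= ?addr0 ?add0r.
Qed.

Lemma act_tensorial F : tensorial (act F).
Proof.
move=> k beta eta _ hb _.
under eq_bigr do under eq_bigr do rewrite act_block.
rewrite exchange_big /= -{1}(tpart_sum eta) !big_bool /=.
have H (b c : bool) : (-1) ^+ (k * (b (+) c)) *: wedge beta (act (etpart (b (+) c) F) (tpart c eta))
    = act (etpart (b (+) c) F) (wedge beta (tpart c eta)).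
  by rewrite (act_wedge _ (etpart_id _ _) hb).
have S zeta : act F zeta = act (etpart true F) zeta + act (etpart false F) zeta.
  by rewrite -{1}(etpart_sum F) big_bool actDl.
have := (H true true, H true false, H false true, H false false) => /= -[[[-> ->] ->] ->].
by rewrite wedgeDr actDr !S [X in X + _ = _]addrC.
Qed.

Lemma act_deg0 F eta p vs : has_degree 0 eta -> act F eta p vs = F p vs (eta p [::]).
Proof.
move=> he; have hh : homog 0 (eta p) by move=> t; exact: he.
 rewrite actE.
rewrite (eq_bigr (fun c => epart c (F p vs) (eta p [::]))) => [|c _].
  by rewrite -sum_lfunE epart_sum.
rewrite (shuffle_homog0r _ _ (bilin_appop _)); last first.
  by move=> t /hh ft; rewrite /sgn_deg ft scaler0.
by rewrite /sgn_deg muln0 scale1r.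
Qed.

End ActAlgebra.

(** * Forms of degree zero and differentials of functions *)

Section ZeroForms.
Context {R : realType} {n : nat} {M : smoothManifold R n}.
Local Notation T := 'rV[R]_n.

Definition zform {W : M -> lmodType R} (s : forall p, W p) : pform W :=
  fun p vs => if vs is [::] then s p else 0.

Lemma zform_degree (W : M -> lmodType R) (s : forall p, W p) : has_degree 0 (zform s).
Proof. by move=> p [|v vs]. Qed.

Lemma zform_alt (W : M -> lmodType R) (s : forall p, W p) p :
  multilinear (zform s p) /\ Defs.alternating (zform s p).
Proof.
split=> [[|x l] t a u v|[|x l] t r u] //=; by rewrite scaler0 addr0.
Qed.

Lemma Omega_scalar_zform (f : M -> R) : smooth_fun setT f ->
  Omega_scalar (zform (W := fun=> R^o) f : sform M).
Proof.
move=> sf; split=> [p|p [|v vs]]; first exact: zform_alt.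
  exact: smooth_fun_sub sf.
by apply: smooth_fun_cst; exact: cdom_open.
Qed.

Lemma Omega_zform (E : superbundle M) (s : forall p, sfiber E p) :
  smooth_ssection setT s -> Omega (zform s : eform E).
Proof.
move=> sf; split=> [p|p [|v vs]]; first exact: zform_alt.
  exact: ssection_sub sf.
by apply: ssection0; exact: cdom_open.
Qed.

Lemma wedge_zform (E : superbundle M) (f : M -> R) (eta : eform E) :
  wedge (zform (W := fun=> R^o) f) eta = fmul f eta.
Proof.
apply: formP => p vs; rewrite wedgeE (shuffle_homog0l _ _ (bilin_scop _)) //.
by move=> t; exact: zform_degree.
Qed.

Definition dfun (f : M -> R) : sform M := ext_d (zform (W := fun=> R^o) f).

Lemma dfun1 f p v : dfun f p [:: v] = 'D_v (f \o unchart p) (chart p p).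
Proof. by rewrite /dfun /ext_d big_ord1 /= expr0 mul1r. Qed.

Lemma dfun_degree f : has_degree 1 (dfun f).
Proof.
move=> p [|v [|w vs]] //= _; first by rewrite /dfun /ext_d big_ord0.
apply: big1 => j _; rewrite (_ : (fun x => _) = cst 0) ?derive_cst ?mulr0 //.
apply/funext => x /=; case: j => [[|j] jl] //=.
Qed.

Lemma smooth_fun_unchart_diff (f : M -> R) (p : M) : smooth_fun setT f ->
  differentiable (f \o unchart p) (chart p p).
Proof. by move=> sf; apply: (smooth_fun_differentiable sf) => //; exact: cdom_center. Qed.

Lemma dfun_coordvec f p q v : smooth_fun setT f -> cdom p q ->
  dfun f q [:: coordvec p q v] = pder p v f q.
Proof.
move=> sf pq; rewrite dfun1 pder_chart //.
exact: smooth_fun_unchart_diff.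
Qed.

Lemma Omega_dfun f : smooth_fun setT f -> Omega_scalar (dfun f).
Proof.
move=> sf; split=> [p|p vs].
  split=> [s t a u v|s t r u]; last first.
    by apply: dfun_degree; rewrite !size_cat /= size_cat /= !addnS.
  case: (altP (size s + size t =P 0)%N) => [/eqP|st]; last first.
    rewrite !dfun_degree ?scaler0 ?addr0 //; by rewrite size_cat /= addnS eqSS.
  rewrite addn_eq0 !size_eq0 => /andP[/eqP -> /eqP ->] /=; rewrite !dfun1.
  by rewrite deriveDr //; exact: smooth_fun_unchart_diff.
have o := @cdom_open _ _ M p.
have [vs1|vs1] := eqVneq (size vs) 1%N; last first.
  apply: (smooth_fun_eq o _ (smooth_fun_cst 0 o)) => q _.
  by rewrite dfun_degree // size_map.
case: vs vs1 => [//|v [|//]] _.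
have sf' : smooth_fun (cdom p) f by exact: smooth_fun_sub sf.
apply: (smooth_fun_eq o _ (smooth_fun_pder (p := p) v o _ sf')) => // q pq.
by rewrite /= dfun_coordvec.
Qed.

(** In the chart centred at the point, d(df) evaluated at two vectors is the
    difference of the two mixed second derivatives of [f]. *)
Lemma ddfun f : smooth_fun setT f -> ext_d (dfun f) = 0.
Proof.
move=> sf; apply: pformP => p vs; rewrite /ext_d -[RHS]/(0 : R).
have o := @cimg_open _ _ M p.
have cp : (chart p @` cdom p) (chart p p) by exists p => //; exact: cdom_center.
have [vs2|vs2] := eqVneq (size vs) 2%N; last first.
  apply: big1 => j _; rewrite (_ : (fun x => _) = cst 0) ?derive_cst ?mulr0 //.
  apply/funext => x; apply: dfun_degree; rewrite size_map size_cat size_takel; last exact: ltnW.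
  rewrite size_drop; apply: contraNneq vs2 => h; apply/eqP; have jl := ltn_ord j.
  by move: h jl; move: (size vs) (nat_of_ord j) => a b; lia.
case: vs vs2 => [//|u [//|v [|//]]] _ /=.
have H (w w' : T) : 'D_w (fun x : T => (dfun f (unchart p x) [:: coordvec p (unchart p x) w'] : R)) (chart p p)
   = 'D_w ('D_w' (f \o unchart p)) (chart p p).
  apply: (derive_eq_on _ o) => // x [q pq <-].
  by rewrite chartK // dfun_coordvec.
rewrite big_ord_recl big_ord1 [X in X * _ + _]expr0 mul1r [X in _ + X * _]expr1 mulN1r.
apply: (etrans (congr2 (fun a b : R => a - b) (H u v) (H v u))).
have sfp : smooth_on (chart p @` (cdom p `&` setT)) (f \o unchart p) by exact: sf.
rewrite setIT in sfp.
apply/eqP; rewrite subr_eq0; apply/eqP.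
refine (@derive_swap R 'rV[R]_n (chart p @` cdom p) (f \o unchart p) (chart p p) u v o cp _ _ _) => [y Oy|w y Oy|w w' y Oy].
- exact: (sfp [::]).
- exact: (sfp [:: w]).
- exact: (sfp [:: w; w']).
Qed.

(** A factor of degree one selects a single position. *)
Lemma shuffle_homog1 (V : lmodType R) (f : seq T -> R^o) (g : seq T -> V) vs :
  homog 1 f -> shuffle scop f g vs =
  \sum_(j < size vs) (-1) ^+ j *: ((f [:: nth 0 vs j] : R) *: g (take j vs ++ drop j.+1 vs)).
Proof.
elim: vs g => [|v vs IH] g hf /=; first by rewrite big_ord0 hf // /scop scale0r.
rewrite big_ord_recl /= drop0 expr0 scale1r; congr (_ + _).
  by rewrite (shuffle_homog0l _ _ (bilin_scop _)) //; exact: ins_homog.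
rewrite (sgn_homog 1 hf) (shuffleZl (bilin_scop _)) IH // scaler_sumr.
by apply: eq_bigr => j _; rewrite scalerA -exprD.
Qed.

(** Moving the argument at position [j] to the front takes [j] transpositions. *)
Lemma alternating_move (V : lmodType R) (g : seq T -> V) vs j :
  multilinear g -> Defs.alternating g -> (j < size vs)%N ->
  g (nth 0 vs j :: take j vs ++ drop j.+1 vs) = (-1) ^+ j *: g vs.
Proof.
elim: vs g j => [//|x vs IH] g [|j] mg ag jl /=; first by rewrite drop0 scale1r.
have := congr1 (fun h => h (take j vs ++ drop j.+1 vs)) (alternatingC (nth 0 vs j) x mg ag).
rewrite {1 2 3}/ins => ->; rewrite -/(ins x g (_ :: _)) IH //; last exact: alternating_ins.
  by rewrite scalerA -exprS.
exact: multilinear_ins.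
Qed.

End ZeroForms.

(** * Operators linear over the forms *)

Section Representation.
Context {R : realType} {n : nat} {M : smoothManifold R n}.
Variable E : superbundle M.
Local Notation fib := (sfiber E).
Local Notation T := 'rV[R]_n.
Implicit Types (eta zeta : eform E) (F G : endform E) (D : eform E -> eform E).

(** An operator of parity [b] that is linear over the forms.  Linearity is required
    for functions and differentials of functions only: these generate all forms locally,
    and for them it can be checked on the square of a superconnection with
    d(df) = 0 alone. *)
Record graded_linear (b : bool) D : Prop := GradedLinearity {
  gl_stab : forall eta, Omega eta -> Omega (D eta);
  gl_lin : forall (a : R) eta zeta, Omega eta -> Omega zeta ->
    D (a *: eta + zeta) = a *: D eta + D zeta;
  gl_par : forall c eta, Omega_ c eta -> tpart (c (+) b) (D eta) = D eta;
  gl_fun : forall f eta, smooth_fun setT f -> Omega eta ->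
    D (fmul f eta) = fmul f (D eta);
  gl_dfun : forall f eta, smooth_fun setT f -> Omega eta ->
    D (wedge (dfun f) eta) = (-1) ^+ b *: wedge (dfun f) (D eta)
}.

Lemma Omega_fmul f eta : smooth_fun setT f -> Omega eta -> Omega (fmul f eta).
Proof.
by move=> sf Oe; rewrite -wedge_zform; apply: Omega_wedge => //; exact: Omega_scalar_zform.
Qed.

Lemma fmul_lin f (a : R) eta zeta :
  fmul f (a *: eta + zeta) = a *: fmul f eta + fmul f zeta.
Proof. by rewrite -!wedge_zform wedge_linr. Qed.

Section GradedLinear.
Variables (b : bool) (D : eform E -> eform E).
Hypothesis tD : graded_linear b D.

Lemma glin0 : D 0 = 0.
Proof.
have := gl_lin tD (-1) (Omega0 E) (Omega0 E).
by rewrite scaler0 addr0 scaleN1r addNr.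
Qed.

Lemma glinZ a eta : Omega eta -> D (a *: eta) = a *: D eta.
Proof.
by move=> Oe; have := gl_lin tD a Oe (Omega0 E); rewrite glin0 !addr0.
Qed.

Lemma glinD eta zeta : Omega eta -> Omega zeta -> D (eta + zeta) = D eta + D zeta.
Proof. by move=> Oe Oz; have := gl_lin tD 1 Oe Oz; rewrite !scale1r. Qed.

Lemma glin_sum (I : Type) (r : seq I) (P : pred I) (h : I -> eform E) :
  (forall i, P i -> Omega (h i)) ->
  D (\sum_(i <- r | P i) h i) = \sum_(i <- r | P i) D (h i).
Proof.
move=> Oh; elim: r => [|i r IH]; first by rewrite !big_nil glin0.
rewrite !big_cons; case Pi : (P i) => //.
by rewrite glinD ?IH //; [exact: Oh|exact: Omega_sum].
Qed.

(** If two forms agree near [q], their products by a bump function supported there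
    agree everywhere. *)
Lemma glin_local eta zeta q : Omega eta -> Omega zeta ->
  (\forall z \near q, eta z = zeta z) -> D eta q = D zeta q.
Proof.
move=> Oe Oz H; have : nbhs q [set z | eta z = zeta z] by exact: H.
rewrite nbhsE => -[U [oU Uq] UH].
have [chi [V [W [sc [oV Vq VU c1] [oW UW c0]]]]] := exists_bump oU Uq.
have E0 : fmul chi eta = fmul chi zeta.
  apply: formP => z vs; rewrite /fmul; case: (UW z) => [/UH /= ->//|/c0 ->].
  by rewrite !scale0r.
have := congr1 D E0; rewrite !(gl_fun tD) // => /(congr1 (fun h : eform E => h q)).
move=> H'; apply/funext => vs; have := congr1 (fun h => h vs) H'.
by rewrite /fmul c1 // !scale1r.
Qed.

End GradedLinear.

Lemma glin_comp b c D D' : graded_linear b D -> graded_linear c D' -> graded_linear (b (+) c) (D' \o D).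
Proof.
move=> tD tD'; split=> /=.
- by move=> eta Oe; apply: (gl_stab tD'); exact: (gl_stab tD).
- move=> a eta zeta Oe Oz; rewrite (gl_lin tD) // (gl_lin tD') //; exact: (gl_stab tD).
- move=> d eta Oe; rewrite addbA; apply: (gl_par tD'); split.
    by apply: (gl_stab tD); case: Oe.
  exact: (gl_par tD).
- move=> f eta sf Oe; rewrite (gl_fun tD) // (gl_fun tD') //; exact: (gl_stab tD).
- move=> f eta sf Oe; have OD := gl_stab tD Oe.
  have OW : Omega (wedge (dfun f) (D eta)) by apply: Omega_wedge => //; exact: Omega_dfun.
  rewrite (gl_dfun tD) // (glinZ tD') // (gl_dfun tD') // scalerA -signr_addb.
  by [].
Qed.

Lemma glin_linear b D D' (a : R) : graded_linear b D -> graded_linear b D' ->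
  graded_linear b (fun eta => a *: D eta + D' eta).
Proof.
move=> tD tD'; split=> /=.
- move=> eta Oe; apply: Omega_lin; [exact: (gl_stab tD)|exact: (gl_stab tD')].
- move=> k eta zeta Oe Oz; rewrite (gl_lin tD) // (gl_lin tD') //.
  by rewrite !scalerDr !scalerA [a * k]mulrC addrACA.
- by move=> c eta Oe; rewrite tpart_lin (gl_par tD) // (gl_par tD').
- by move=> f eta sf Oe; rewrite (gl_fun tD) // (gl_fun tD') // fmul_lin.
- move=> f eta sf Oe; rewrite (gl_dfun tD) // (gl_dfun tD') // wedge_linr.
  by rewrite scalerDr !scalerA [a * _]mulrC.
Qed.

Lemma glin_id : graded_linear false id.
Proof.
split=> //; first by move=> c eta [_ ?]; rewrite addbF.
by move=> f eta _ _; rewrite scale1r.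
Qed.

Lemma glin_zero b : graded_linear b (fun=> 0).
Proof.
split=> //.
- by move=> *; exact: Omega0.
- by move=> *; rewrite scaler0 addr0.
- move=> c eta _; have := tpart_lin (c (+) b) (-1) (0 : eform E) 0.
  by rewrite scaler0 addr0 scaleN1r addNr.
- by move=> f eta _ _; rewrite -wedge_zform wedge0r.
- by move=> f eta _ _; rewrite wedge0r scaler0.
Qed.

Lemma glin_act b F : OmegaEnd_ b F -> graded_linear b (act F).
Proof.
move=> [OF pF]; split.
- by move=> eta; exact: Omega_act.
- by move=> *; exact: act_linr.
- by move=> c eta [_ pe]; exact: act_tpart.
- by move=> f eta _ _; rewrite -!wedge_zform (act_wedge _ pF (zform_degree _)) mul0n scale1r.
- by move=> f eta _ _; rewrite (act_wedge _ pF (@dfun_degree _ _ _ f)) mul1n.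
Qed.

(** The interior product with the coordinate field i of the chart at [q], cut off
    to make it globally defined. *)
Definition contract (chi : M -> R) (q : M) (i : 'I_n) eta : eform E :=
  fun z vs => chi z *: eta z (coordvec q z (delta_mx 0 i) :: vs).

(** In another chart the coordinate field is a combination of the coordinate fields
    of that chart with smooth coefficients. *)
Lemma Omega_contract chi q (i : 'I_n) eta W : smooth_fun setT chi ->
  open W -> (forall z, cdom q z \/ W z) -> (forall z, W z -> chi z = 0) ->
  Omega eta -> Omega (contract chi q i eta).
Proof.
move=> sc oW UW c0 [m1 s1]; split=> [p|p vs].
  have [f1 f2] := m1 p; split=> [s t a u v|s t r u]; rewrite /contract -!cat_cons.
    by rewrite f1 scalerDr !scalerA mulrC.
  by rewrite f2 scaler0.
apply: ssection_local => z0 pz0; case: (UW z0) => [qz0|Wz0]; last first.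
  exists W => //; apply: (ssection_eq oW _ (@ssection0 _ _ _ E _ oW)) => z /c0 cz.
  by rewrite /contract cz scale0r.
have o : open (cdom q `&` cdom p) by apply: openI; exact: cdom_open.
exists (cdom q `&` cdom p) => //.
have S : smooth_ssection (cdom q `&` cdom p) (fun z => chi z *:
    \sum_(j < n) dtrans q p z (delta_mx 0 i) 0 j *:
       eta z (map (coordvec p z) (delta_mx 0 j :: vs))).
  apply: ssectionZ => //; first exact: smooth_fun_sub sc.
  apply: ssection_sum => // j _; apply: ssectionZ => //; first exact: smooth_fun_dtrans.
  exact: ssection_sub (s1 p (delta_mx 0 j :: vs)).
apply: (ssection_eq o _ S) => z [qz pz]; rewrite /contract; congr (_ *: _).
rewrite [in RHS](coordvecE q) -(@dtrans_comp _ _ _ q p z z) //; last exact: cdom_center.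
rewrite [dtrans p z z _]dtrans_sum //; last exact: cdom_center.
have [f1 _] := m1 z.
by rewrite (multilinear_sum _ _ _ [::] _ f1).
Qed.

Lemma contract_degree chi q i k eta : has_degree k.+1 eta ->
  has_degree k (contract chi q i eta).
Proof. by move=> he p vs hs; rewrite /contract he ?scaler0. Qed.

(** At a point where the cut-offs are 1 this is
    \sum_i dx^i /\ (iota_i eta) = k eta for eta of degree k: each of the k arguments,
    expanded in the coordinate fields, recovers eta once. *)
Lemma euler_identity (chi : M -> R) q (f : 'I_n -> M -> R) z k eta :
  cdom q z -> chi z = 1 -> Omega eta -> has_degree k eta ->
  (forall i, exists V : set M, [/\ open V, V z & forall y, V y -> f i y = chart q y 0 i]) ->
  (\sum_(i < n) wedge (dfun (f i)) (contract chi q i eta)) z = (k%:R *: eta : eform E) z.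
Proof.
move=> qz c1 [m1 _] hk Hf; have [e1 e2] := m1 z.
have fE i v : dfun (f i) z [:: v] = dtrans z q z v 0 i.
  have [V [oV Vz VE]] := Hf i.
  rewrite dfun1 /dtrans derive_rV; last by apply: dtrans_differentiable => //; exact: cdom_center.
  apply: (@derive_eq_on _ _ _ _ _ _ _ _ (@open_cimg _ _ _ z _ oV)).
    by move=> x [y [zy Vy] <-] /=; rewrite chartK // VE.
  by exists z => //; split=> //; exact: cdom_center.
apply/funext => vs; rewrite -[RHS]/(k%:R *: eta z vs).
have sumE (r : seq 'I_n) (h : 'I_n -> eform E) :
    (\sum_(i <- r) h i) z vs = \sum_(i <- r) h i z vs.
  by elim: r => [|i r IH]; rewrite ?big_nil ?big_cons // -IH.
rewrite sumE.
have hd i : homog 1 (dfun (f i) z) by move=> t; exact: dfun_degree.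
under eq_bigr do rewrite wedgeE (shuffle_homog1 _ _ (hd _)).
rewrite exchange_big /=.
have step (j : 'I_(size vs)) :
   \sum_(i < n) (-1) ^+ j *: ((dfun (f i) z [:: nth 0 vs j] : R) *:
      contract chi q i eta z (take j vs ++ drop j.+1 vs)) = eta z vs.
  rewrite -scaler_sumr.
  under eq_bigr do rewrite fE /contract c1 scale1r.
  rewrite -(multilinear_sum _ (fun i => dtrans z q z (nth 0 vs j) 0 i)
     (fun i => coordvec q z (delta_mx 0 i)) [::] _ e1) /=.
  rewrite (eq_bigr (fun i => dtrans z q z (nth 0 vs j) 0 i *: dtrans q z z (delta_mx 0 i))) //.
  have zz := @cdom_center _ _ M z.
  rewrite -dtrans_sum // dtrans_comp // dtrans_id // alternating_move //.
  by rewrite scalerA -exprMn mulrNN mulr1 expr1n scale1r.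
under eq_bigr do rewrite step.
rewrite sumr_const card_ord scaler_nat.
by have [->//|/hk ->] := eqVneq (size vs) k; rewrite !mul0rn.
Qed.

Lemma form_deg0 eta : has_degree 0 eta -> eta = zform (fun q => eta q [::]).
Proof. by move=> he; apply: formP => p [|v vs] //=; exact: he. Qed.

Lemma smooth_form0 eta : Omega eta -> smooth_ssection setT (fun q => eta q [::]).
Proof.
move=> [_ s1]; apply: ssection_local => q _; exists (cdom q).
  exact: cdom_center.
exact: (s1 q [::]).
Qed.

(** Induction on the degree: near a point, (k+1) eta is a sum of products of
    differentials with forms of degree k. *)
Lemma glin_vanish_homog b D : graded_linear b D ->
  (forall s : forall p, fib p, smooth_ssection setT s -> D (zform s) = 0) ->
  forall k eta, Omega eta -> has_degree k eta -> D eta = 0.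
Proof.
move=> tD Ds k; elim: k => [|k IH] eta Oe hk.
  by rewrite (form_deg0 hk) Ds //; exact: smooth_form0.
apply: formP => q vs.
have qq := @cdom_center _ _ M q; have oq := @cdom_open _ _ M q.
have [chi [V0 [W [sc [oV0 V0q V0U c1] [oW UW c0]]]]] := exists_bump oq qq.
(* Global functions that coincide with the coordinates of the chart at [q] near [q]. *)
have /choice[fV HfV] : forall i : 'I_n, exists gV : (M -> R) * set M,
    [/\ smooth_fun setT gV.1, open gV.2, gV.2 q & forall y, gV.2 y -> gV.1 y = chart q y 0 i].
  move=> i; have [g [V [sg oV Vq _ gE]]] := smooth_extend oq qq (@smooth_fun_coord _ _ M q i).
  by exists (g, V).
pose f i := (fV i).1.
have Oc i : Omega (contract chi q i eta) by exact: Omega_contract sc oW UW c0 Oe.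
have Ow i : Omega (wedge (dfun (f i)) (contract chi q i eta)).
  by apply: Omega_wedge => //; apply: Omega_dfun; case: (HfV i).
have H : D (\sum_(i < n) wedge (dfun (f i)) (contract chi q i eta)) q = D (k.+1%:R *: eta) q.
  apply: (glin_local tD); [exact: Omega_sum|exact: OmegaZ|].
  have N1 : \forall z \near q, V0 z by exact: open_nbhs_nbhs.
  have N2 : \forall z \near q, forall i, (fV i).2 z.
    by apply: filter_forall => i; case: (HfV i) => _ oV Vq _; exact: open_nbhs_nbhs.
  apply: filterS2 N1 N2 => z V0z Vz; apply: euler_identity => //.
  - exact: V0U.
  - exact: c1.
  - by move=> i; exists (fV i).2; case: (HfV i).
have H2 : D (\sum_(i < n) wedge (dfun (f i)) (contract chi q i eta)) = 0.
  rewrite (glin_sum tD) // big1 // => i _.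
  rewrite (gl_dfun tD) //; last by case: (HfV i).
  by rewrite IH ?wedge0r ?scaler0 //; exact: contract_degree.
move: H; rewrite H2 (glinZ tD) // => /(congr1 (fun h => h vs)) /esym.
rewrite -[LHS]/(k.+1%:R *: D eta q vs) -[RHS]/(0 : fib q) => /eqP.
by rewrite scaler_eq0 pnatr_eq0 /= => /eqP.
Qed.

Definition hpart k eta : eform E := fun p vs => if size vs == k then eta p vs else 0.

Lemma Omega_hpart k eta : Omega eta -> Omega (hpart k eta).
Proof.
move=> [m1 s1]; split=> [p|p vs].
  have [f1 f2] := m1 p; split=> [s t a u v|s t r u]; rewrite /hpart.
    by rewrite !size_cat /=; case: ifP => _; rewrite ?f1 // scaler0 addr0.
  by case: ifP => _; rewrite ?f2.
have o := @cdom_open _ _ M p; rewrite /hpart.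
have [h|h] := boolP (size vs == k).
  by apply: (ssection_eq o _ (s1 p vs)) => q _; rewrite size_map h.
by apply: (ssection_eq o _ (@ssection0 _ _ _ E _ o)) => q _; rewrite size_map (negbTE h).
Qed.

Lemma hpart_sum eta : Omega eta -> eta = \sum_(k < n.+1) hpart k eta.
Proof.
move=> [m1 _]; apply: formP => p vs.
have sumE (r : seq 'I_n.+1) : (\sum_(i <- r) hpart i eta) p vs = \sum_(i <- r) hpart i eta p vs.
  by elim: r => [|i r IH]; rewrite ?big_nil ?big_cons // -IH.
rewrite sumE /hpart; have [vn|vn] := leqP (size vs) n.
  rewrite (bigD1 (Ordinal (n := n.+1) (m := size vs) vn)) //= eqxx big1 ?addr0 // => i ni.
  by rewrite ifN //; apply: contra ni => /eqP h; apply/eqP; apply: val_inj.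
by have [f1 f2] := m1 p; rewrite (alternating_vanish f1 f2 vn) big1 // => i _; case: ifP.
Qed.

(** A form is the finite sum of its components of degree at most [n]. *)
Lemma glin_vanish b D : graded_linear b D ->
  (forall s : forall p, fib p, smooth_ssection setT s -> D (zform s) = 0) ->
  forall eta, Omega eta -> D eta = 0.
Proof.
move=> tD Ds eta Oe; rewrite (hpart_sum Oe) (glin_sum tD) => [|k _]; last exact: Omega_hpart.
apply: big1 => k _; apply: (glin_vanish_homog tD Ds (k := k)); first exact: Omega_hpart.
by move=> p vs /negbTE h; rewrite /hpart h.
Qed.

End Representation.

(** * Linear operators are given by endomorphism-valued forms *)

Section RepresentationTheorem.
Context {R : realType} {n : nat} {M : smoothManifold R n}.
Variable E : superbundle M.
Local Notation fib := (sfiber E).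
Local Notation T := 'rV[R]_n.
Implicit Types (eta zeta : eform E) (F G : endform E) (D : eform E -> eform E).

Lemma frame_ext q : exists s : sindex E q -> forall p, fib p, forall i,
  smooth_ssection setT (s i) /\ \forall z \near q, s i z = sframe i z.
Proof.
have H (i : sindex E q) : exists s : forall p, fib p,
    smooth_ssection setT s /\ \forall z \near q, s z = sframe i z.
  have [s [V [ss oV Vq _ sE]]] := ssection_extend (@sfdom_open _ _ _ E q) (@sfdom_center _ _ _ E q)
    (@ssection_sframe _ _ _ E q i).
  by exists s; split=> //; apply: filterS (open_nbhs_nbhs (conj oV Vq)).
by have /choice[s Hs] := H; exists s.
Qed.

(** Global sections that coincide with the frame at [q] near [q]. *)
Definition gframe q : sindex E q -> forall p, fib p := projT1 (cid (frame_ext q)).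

Lemma gframe_smooth q i : smooth_ssection setT (@gframe q i).
Proof. by have [] := projT2 (cid (frame_ext q)) i. Qed.

Lemma gframe_near q i : \forall z \near q, @gframe q i z = sframe i z.
Proof. by have [] := projT2 (cid (frame_ext q)) i. Qed.

(** A global section with value [w] at [q]. *)
Definition through q (w : fib q) : forall p, fib p :=
  fun p => \sum_(i : sindex E q) scoord i w *: gframe i p.

Lemma through_smooth q (w : fib q) : smooth_ssection setT (through w).
Proof.
have o := openT (T := M); apply: ssection_sum => // i _.
by apply: ssectionZ => //; [exact: smooth_fun_cst|exact: gframe_smooth].
Qed.

Lemma throughE q (w : fib q) : through w q = w.
Proof.
rewrite [RHS](sframe_expand w (@sfdom_center _ _ _ E q)).
by apply: eq_bigr => i _; rewrite (nbhs_singleton (gframe_near i)).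
Qed.

(** The value at [w] is the operator applied to a global section with value [w] at
    [q]; expressing it through the frame makes it linear in [w] by construction. *)
Definition symbol_fun D q vs (w : fib q) : fib q :=
  \sum_(i : sindex E q) scoord i w *: D (zform (gframe i)) q vs.

Definition symbol D : endform E := fun q vs => linfun (symbol_fun D vs : fib q -> fib q).

Lemma symbolE D q vs (w : fib q) : symbol D q vs w = symbol_fun D vs w.
Proof.
have linf : linear (symbol_fun D vs : fib q -> fib q).
  move=> a u v; rewrite /symbol_fun scaler_sumr -big_split; apply: eq_bigr => i _.
  by rewrite scoord_linear scalerDl scalerA.
pose lin := GRing.isLinear.Build R (fib q) (fib q) _ (symbol_fun D vs : fib q -> fib q) linf.
pose L : {linear fib q -> fib q} := HB.pack (symbol_fun D vs : fib q -> fib q) lin.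
by rewrite /symbol -[RHS]/(L w) -(lfunE L).
Qed.

Section Symbol.
Variables (b : bool) (D : eform E -> eform E).
Hypothesis tD : graded_linear b D.

Lemma eform_sumE (I : Type) (r : seq I) (h : I -> eform E) q vs :
  (\sum_(i <- r) h i) q vs = \sum_(i <- r) h i q vs.
Proof. by elim: r => [|i r IH]; rewrite ?big_nil ?big_cons // -IH. Qed.

(** Near [q] the section is a combination of the global frame sections with smooth
    coefficients, which come out of the operator. *)
Lemma symbol_section (s : forall p, fib p) q vs : smooth_ssection setT s ->
  D (zform s) q vs = symbol D q vs (s q).
Proof.
move=> ss; rewrite symbolE /symbol_fun.
have oq := @sfdom_open _ _ _ E q; have qq := @sfdom_center _ _ _ E q.
have /choice[c Hc] : forall i : sindex E q, exists g : M -> R,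
    smooth_fun setT g /\ \forall z \near q, g z = scoord i (s z).
  move=> i; have sc : smooth_fun (sfdom E q) (fun z => scoord i (s z)).
    by apply: smooth_fun_sub (smooth_scoord i ss) => z.
  have [g [V [sg oV Vq _ gE]]] := smooth_extend oq qq sc.
  by exists g; split=> //; apply: filterS (open_nbhs_nbhs (conj oV Vq)).
have Og i : Omega (zform (gframe i) : eform E) by apply: Omega_zform; exact: gframe_smooth.
have Ocg i : Omega (fmul (c i) (zform (gframe i)) : eform E).
  by apply: Omega_fmul => //; case: (Hc i).
have H : D (zform s) q = D (\sum_i fmul (c i) (zform (gframe i))) q.
  apply: (glin_local tD); [exact: Omega_zform|exact: Omega_sum|].
  have N1 : \forall z \near q, forall i, c i z = scoord i (s z).
    by apply: filter_forall => i; case: (Hc i).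
  have N2 : \forall z \near q, forall i, @gframe q i z = sframe i z.
    by apply: filter_forall => i; exact: gframe_near.
  have N3 : \forall z \near q, sfdom E q z by exact: open_nbhs_nbhs.
  apply: filterS3 N1 N2 N3 => z z1 z2 z3; apply/funext => ws.
  rewrite eform_sumE; case: ws => [|w ws]; last first.
    by rewrite big1 // => i _; rewrite /fmul /= scaler0.
  rewrite /= [LHS](sframe_expand _ z3); apply: eq_bigr => i _.
  by rewrite /fmul /= z1 z2.
rewrite H (glin_sum tD) // eform_sumE; apply: eq_bigr => i _.
have [sc cN] := Hc i.
by rewrite (gl_fun tD) // /fmul (nbhs_singleton cN).
Qed.

Lemma symbol_OmegaEnd : OmegaEnd_ b (symbol D).
Proof.
have Oz q (i : sindex E q) : Omega (D (zform (gframe i))).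
  by apply: (gl_stab tD); apply: Omega_zform; exact: gframe_smooth.
split; last first.
  apply: pformP => q vs; apply: epart_fixP => c w.
  set s := through w.
  have ss : smooth_ssection setT (fun p => vpart c (s p)).
    by apply: ssection_vpart; [exact: openT|exact: through_smooth].
  have Os : Omega_ c (zform (fun p => vpart c (s p)) : eform E).
    split; first exact: Omega_zform.
    apply: formP => p [|v ws]; rewrite /tpart /=; last exact: vpart0.
    by rewrite addbF vpart_vpart eqxx.
  have := symbol_section q vs ss; rewrite /s throughE => <-.
  by have := congr1 (fun h : eform E => h q vs) (gl_par tD Os); rewrite /tpart -addbA.
split=> [q|p vs].
  split=> [s t a u v|s t r u].
    apply/lfunP => w; rewrite add_lfunE scale_lfunE !symbolE /symbol_fun.
    rewrite scaler_sumr -big_split; apply: eq_bigr => i _ /=.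
    by have [f1 _] := (Oz q i).1 q; rewrite f1 scalerDr !scalerA mulrC.
  apply/lfunP => w; rewrite zero_lfunE symbolE /symbol_fun big1 // => i _.
  by have [_ f2] := (Oz q i).1 q; rewrite f2 scaler0.
have o := @cdom_open _ _ M p.
apply/(esectionP _ o) => V s Vp oV ss.
apply: ssection_local => q0 Vq0.
have [s' [V0 [ss' oV0 Vq V0V sE]]] := ssection_extend oV Vq0 ss.
exists V0 => //.
have [_ /(_ p vs) S] := gl_stab tD (Omega_zform ss').
apply: (ssection_eq oV0 _ (ssection_sub (fun z h => Vp _ (V0V _ h)) S)) => z V0z.
by rewrite symbol_section // sE.
Qed.

(** The difference of the two sides is linear over the forms and vanishes on sections. *)
Lemma symbol_act eta : Omega eta -> D eta = act (symbol D) eta.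
Proof.
move=> Oe; apply/eqP; rewrite -subr_eq0; apply/eqP.
have tA := glin_act symbol_OmegaEnd.
(* The operator [eta |-> - act (symbol D) eta + D eta]. *)
have tB := glin_linear (-1) tA tD.
have := glin_vanish tB _ Oe; rewrite scaleN1r addrC; apply=> s ss.
rewrite scaleN1r addrC; apply/eqP; rewrite subr_eq0; apply/eqP.
apply: formP => q vs.
by rewrite symbol_section // act_deg0 //; exact: zform_degree.
Qed.

End Symbol.

(** On sections the action is pointwise evaluation, and there is a section through
    every vector. *)
Lemma act_inj F G : (forall eta, Omega eta -> act F eta = act G eta) -> F = G.
Proof.
move=> H; apply: pformP => q vs; apply/lfunP => w.
have Os : Omega (zform (through w) : eform E).
  by apply: Omega_zform; exact: through_smooth.
have := congr1 (fun h : eform E => h q vs) (H _ Os).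
by rewrite !act_deg0 ?[zform _ _ _]throughE //; exact: zform_degree.
Qed.

Lemma epart_shuffle c p (f : seq T -> R^o) (g : seq T -> 'End(fib p)) vs :
  epart c (shuffle scop f g vs) = shuffle scop f (fun t => epart c (g t)) vs.
Proof.
elim: vs f g => [|v vs IH] f g /=; first exact: epartZ.
by have := epart_lin c 1 (shuffle scop (ins v f) g vs)
  (shuffle scop (sgn_deg 1 f) (ins v g) vs); rewrite !scale1r => ->; rewrite !IH.
Qed.

Lemma act_wedgel alpha F eta : act (wedge alpha F) eta = wedge alpha (act F eta).
Proof.
apply: formP => p vs; rewrite wedgeE actE.
have -> : act F eta p = (fun t => 1 *: shuffle appop (Fpart F true p) (sgn_deg true (eta p)) t +
    shuffle appop (Fpart F false p) (sgn_deg false (eta p)) t).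
  by apply/funext => t; rewrite actE big_bool scale1r.
rewrite (shuffle_linr (bilin_scop _)) scale1r big_bool.
have H (c : bool) : Fpart (wedge alpha F) c p = shuffle scop (alpha p) (Fpart F c p).
  apply/funext => t; rewrite -epart_shuffle /Fpart; congr epart.
  exact: wedgeE.
rewrite !H; congr (_ + _); apply/esym;
  apply: shuffle_assoc (bilin_scop _) (bilin_appop _) (bilin_appop _) (bilin_scop _) _ => x y z;
  by rewrite /scop /appop scale_lfunE.
Qed.

Lemma OmegaEnd0 : OmegaEnd (0 : endform E).
Proof.
split=> [p|p vs].
  by split=> [s t b u v|s t r u] //; rewrite -[LHS]/0 -[RHS]/(b *: 0 + 0) scaler0 addr0.
have o := @cdom_open _ _ M p; apply/(esectionP _ o) => V s Vp oV ss.
apply: (ssection_eq oV _ (@ssection0 _ _ _ E _ oV)) => q _.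
by rewrite -[(0 : endform E) _ _]/0 zero_lfunE.
Qed.

Lemma op_identified0 D : (forall eta, Omega eta -> D eta = 0) -> op_identified D 0.
Proof.
move=> D0; split.
- exact: OmegaEnd0.
- move=> k beta eta Ob _ Oe; rewrite D0; last exact: Omega_wedge.
  rewrite big1 // => b _; rewrite big1 // => c _.
  rewrite /block D0; last exact: Omega_tpart.
  have := tpart_lin b (-1) (0 : eform E) 0; rewrite scaler0 addr0 scaleN1r addNr => ->.
  by rewrite wedge0r scaler0.
- by move=> eta Oe; rewrite D0 // act0l.
Qed.

End RepresentationTheorem.

(** * Powers of a primitive superconnection *)

Section Main.
Context {R : realType} {n : nat} {M : smoothManifold R n}.
Variables (omega : sform M) (E : superbundle M).
Hypothesis Homega : symplectic omega.
Variable AA : primitive_superconnection E omega.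
Implicit Types (eta zeta : eform E) (F G : endform E).
Local Notation A := (ps_conn AA).
Local Notation B := (ps_end AA).

Let cA : superconnection A := ps_connP AA.
Let eB : OmegaEnd_ false B := ps_endP AA.
Let Oom := symplectic_smooth Homega.
Let dom := symplectic_degree Homega.

Lemma conn_lin (a : R) eta zeta : Omega eta -> Omega zeta ->
  A (a *: eta + zeta) = a *: A eta + A zeta.
Proof. exact: (sc_linear cA). Qed.

Lemma connD eta zeta : Omega eta -> Omega zeta -> A (eta + zeta) = A eta + A zeta.
Proof. by move=> Oe Oz; have := conn_lin 1 Oe Oz; rewrite !scale1r. Qed.

Lemma conn0 : A 0 = 0.
Proof.
have := conn_lin (-1) (Omega0 E) (Omega0 E).
by rewrite scaler0 addr0 scaleN1r addNr.
Qed.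

Lemma connZ a eta : Omega eta -> A (a *: eta) = a *: A eta.
Proof. by move=> Oe; have := conn_lin a Oe (Omega0 E); rewrite conn0 !addr0. Qed.

Lemma conn_fmul f eta : smooth_fun setT f -> Omega eta ->
  A (fmul f eta) = wedge (dfun f) eta + fmul f (A eta).
Proof.
move=> sf Oe; rewrite -!wedge_zform (sc_leibniz cA (k := 0)) ?expr0 ?scale1r //.
  exact: Omega_scalar_zform.
exact: zform_degree.
Qed.

Lemma conn_dfun f eta : smooth_fun setT f -> Omega eta ->
  A (wedge (dfun f) eta) = - wedge (dfun f) (A eta).
Proof.
move=> sf Oe; rewrite (sc_leibniz cA (k := 1)) //; last exact: dfun_degree.
  by rewrite ddfun // wedge0l add0r expr1 scaleN1r.
exact: Omega_dfun.
Qed.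

(** The term with the differential of omega vanishes, and omega is even. *)
Lemma conn_omega eta : Omega eta -> A (wedge omega eta) = wedge omega (A eta).
Proof.
move=> Oe; rewrite (sc_leibniz cA Oom dom Oe) (symplectic_closed Homega).
by rewrite wedge0l add0r sqrrN expr1n scale1r.
Qed.

Lemma Omega_conn eta : Omega eta -> Omega (A eta).
Proof. exact: (sc_stable cA). Qed.

Lemma Omega_omega eta : Omega eta -> Omega (wedge omega eta).
Proof. exact: Omega_wedge. Qed.

Lemma Omega_B eta : Omega eta -> Omega (act B eta).
Proof. by case: eB => OB _; exact: Omega_act. Qed.

Lemma B_omega eta : act B (wedge omega eta) = wedge omega (act B eta).
Proof. by case: eB => _ pB; rewrite (act_wedge _ pB dom) muln0 scale1r. Qed.

Lemma glin_omega : graded_linear false (wedge omega : eform E -> eform E).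
Proof.
split.
- exact: Omega_omega.
- by move=> *; exact: wedge_linr.
- by move=> c eta [_ pe]; have := wedge_tpart dom pe.
- move=> f eta _ _; rewrite -!wedge_zform (wedgeC _ dom (zform_degree _)).
  by rewrite muln0 scale1r.
- move=> f eta _ _; rewrite (wedgeC _ dom (@dfun_degree _ _ _ f)) muln1.
  by rewrite sqrrN expr1n.
Qed.

(** The two mixed terms df /\ A eta coming from the Leibniz rule cancel, and
    d(df) = 0 removes the remaining one. *)
Lemma glin_connA : graded_linear false (fun eta => A (A eta)).
Proof.
split.
- by move=> eta Oe; do 2 apply: Omega_conn.
- by move=> a eta zeta Oe Oz; rewrite conn_lin // conn_lin //; exact: Omega_conn.
- move=> c eta Oe; have [_] := sc_odd cA (sc_odd cA Oe).
  by rewrite negbK addbF.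
- move=> f eta sf Oe; have OA := Omega_conn Oe.
  have OD : Omega (wedge (dfun f) eta) by apply: Omega_wedge => //; exact: Omega_dfun.
  rewrite conn_fmul // connD //; last exact: Omega_fmul.
  by rewrite conn_dfun // conn_fmul // addrA addNr add0r.
- move=> f eta sf Oe; have OA := Omega_conn Oe.
  have OD : Omega (wedge (dfun f) (A eta)) by apply: Omega_wedge => //; exact: Omega_dfun.
  by rewrite conn_dfun // -scaleN1r connZ // conn_dfun // scaleN1r opprK expr0 scale1r.
Qed.

Definition curv eta : eform E := A (A eta) + wedge omega (act B eta).
Definition commBA eta : eform E := act B (A eta) - A (act B eta).

Lemma glin_curv : graded_linear false curv.
Proof.
have := glin_linear 1 glin_connA (glin_comp (glin_act eB) glin_omega).
rewrite /curv; congr (graded_linear false _).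
by apply/funext => eta; rewrite scale1r.
Qed.

Lemma glin_commBA : graded_linear true commBA.
Proof.
have [OB pB] := eB; split; rewrite /commBA.
- by move=> eta Oe; apply: OmegaB; [apply: Omega_B; exact: Omega_conn|apply: Omega_conn; exact: Omega_B].
- move=> a eta zeta Oe Oz; rewrite conn_lin // !act_linr conn_lin; try exact: Omega_B.
  by rewrite scalerBr opprD addrACA.
- move=> c eta Oe; have [Oe' pe] := Oe.
  have [_ p1] := sc_odd cA Oe.
  have h1 : Omega_ c (act B eta).
    by split; [exact: Omega_B|have := act_tpart pB pe; rewrite addbF].
  have [_ p2] := sc_odd cA h1.
  have p3 := act_tpart pB p1; rewrite addbF in p3.
  have := tpart_lin (c (+) true) (-1) (A (act B eta)) (act B (A eta)).
  by rewrite addbT p2 p3 scaleN1r addrC.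
- move=> f eta sf Oe; rewrite conn_fmul // actDr.
  have h1 : act B (wedge (dfun f) eta) = wedge (dfun f) (act B eta).
    by rewrite (act_wedge _ pB (@dfun_degree _ _ _ f)) muln0 scale1r.
  have h2 zeta : act B (fmul f zeta) = fmul f (act B zeta).
    by rewrite -!wedge_zform (act_wedge _ pB (zform_degree _)) muln0 scale1r.
  rewrite h1 !h2 conn_fmul //; last exact: Omega_B.
  rewrite opprD addrACA addrN add0r.
  have := fmul_lin f (-1) (A (act B eta)) (act B (A eta)).
  by rewrite !scaleN1r ![- _ + _]addrC.
- move=> f eta sf Oe.
  have h1 zeta : act B (wedge (dfun f) zeta) = wedge (dfun f) (act B zeta).
    by rewrite (act_wedge _ pB (@dfun_degree _ _ _ f)) muln0 scale1r.
  rewrite conn_dfun // h1 conn_dfun //; last exact: Omega_B.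
  rewrite -[X in act B X]scaleN1r actZr h1 scaleN1r opprK /= expr1 scaleN1r.
  have := wedge_linr (dfun f) (-1) (A (act B eta)) (act B (A eta)).
  by rewrite !scaleN1r ![- _ + _]addrC => ->; rewrite opprB addrC.
Qed.

(** The two terms omega /\ A zeta cancel in the first component, as omega commutes
    with A; in the second one omega moves past B. *)
Lemma ps_map2 eta zeta : Omega eta -> Omega zeta ->
  ps_map AA (ps_map AA (eta, zeta)) = (curv eta, commBA eta + curv zeta).
Proof.
move=> Oe Oz; have OA := Omega_conn; have Ow := Omega_omega; have OB := Omega_B.
rewrite /ps_map /=; congr pair.
  rewrite connD; [|exact: OA|exact: Ow].
  rewrite conn_omega // -[- A zeta]scaleN1r wedgeDr wedgeZr scaleN1r /curv.
  by rewrite -addrA; congr (_ + _); rewrite addrC subrK.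
rewrite actDr B_omega -[- A zeta]scaleN1r connD; [|exact: OB|by apply: OmegaZ; exact: OA].
rewrite connZ; last exact: OA.
rewrite scaleN1r opprD opprK /commBA /curv addrACA; congr (_ + _).
exact: addrC.
Qed.

Lemma iter_ps_map k : exists Fo Go : eform E -> eform E,
  [/\ graded_linear false Fo, graded_linear true Go & forall eta zeta, Omega eta -> Omega zeta ->
    iter (2 * k) (ps_map AA) (eta, zeta) = (Fo eta, Go eta + Fo zeta)].
Proof.
elim: k => [|k [Fo [Go [tF tG H]]]].
  exists id, (fun=> 0); split; [exact: glin_id|exact: glin_zero|].
  by move=> eta zeta _ _; rewrite muln0 add0r.
exists (curv \o Fo), (fun eta => 1 *: (commBA \o Fo) eta + (curv \o Go) eta); split.
- exact: (glin_comp tF glin_curv).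
- apply: glin_linear; first exact: (glin_comp tF glin_commBA).
  exact: (glin_comp tG glin_curv).
- move=> eta zeta Oe Oz; rewrite mulnS add2n !iterS H //.
  have OF := gl_stab tF; have OG := gl_stab tG.
  rewrite ps_map2; [|exact: OF|by apply: OmegaD; [exact: OG|exact: OF]].
  rewrite (glinD glin_curv); [|exact: OG|exact: OF].
  by rewrite scale1r addrA.
Qed.

End Main.

Theorem proposition2p5 (R : realType) (n : nat) (M : smoothManifold R n)
    (omega : sform M) (Homega : symplectic omega) (E : superbundle M)
    (AA : primitive_superconnection E omega) (k : nat) :
  exists F G : endform E,
    [/\ OmegaEnd_ false F, OmegaEnd_ true G,
        pair_identified (iter (2 * k) (ps_map AA)) F G,
        (forall F' G' : endform E,
           pair_identified (iter (2 * k) (ps_map AA)) F' G' ->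
           F' = F /\ G' = G) &
        pbracket_is AA F G (0%R : endform E) (0%R : endform E)].
Proof.
have [Fo [Go [tF tG H]]] := iter_ps_map Homega AA k.
have FoE := symbol_act tF; have GoE := symbol_act tG.
have [OF pF] := symbol_OmegaEnd tF; have [OG pG] := symbol_OmegaEnd tG.
move: (symbol Fo) (symbol Go) FoE GoE OF pF OG pG => F G FoE GoE OF pF OG pG.
have O0 := Omega0 E.
have pF1 : etpart true F = 0 by rewrite -pF etpart_etpart.
have pG0 : etpart false G = 0 by rewrite -pG etpart_etpart.
exists F, G; split=> //.
- exists (act F), (act G); split.
  + by split=> //; exact: act_tensorial.
  + by split=> //; exact: act_tensorial.
  + move=> alpha beta Oa Ob; rewrite H // FoE // GoE //; congr (_, _ + _).
    rewrite FoE // -{1}(tpart_sum beta) !big_bool /= !act_block /= pF pF1 !act0l.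
    by rewrite !scaler0 expr0 !scale1r actDr addr0 add0r.
- move=> F' G' [D [Dt [[_ _ DF'] [_ _ DG'] HD]]].
  have FF : F' = F.
    apply: act_inj => eta Oe; rewrite -FoE // -DF' //.
    by have := HD eta 0 Oe O0; rewrite H // => -[-> _].
  split=> //; apply: act_inj => eta Oe; rewrite -GoE // -DG' //.
  have := HD eta 0 Oe O0; rewrite H // => -[_]; rewrite (glin0 tF) addr0 => ->.
  have tp0 b : tpart b (0 : eform E) = 0.
    by have := tpart_lin b (-1) (0 : eform E) 0; rewrite scaler0 addr0 scaleN1r addNr.
  have D0 : D 0 = 0 by rewrite DF' // act0r.
  rewrite big1 ?addr0 // => b _; rewrite big1 // => c _.
  by rewrite /block tp0 D0 tp0 scaler0.
- have K eta : Omega eta ->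
      (ps_conn AA (Fo eta) + wedge omega (Go eta), act (ps_end AA) (Fo eta) - ps_conn AA (Go eta)) =
      (Fo (ps_conn AA eta), Go (ps_conn AA eta) + Fo (act (ps_end AA) eta)).
    move=> Oe; have Oc := Omega_conn AA Oe; have OB := Omega_B AA Oe.
    have := iterSr (2 * k) (ps_map AA) (eta, 0).
    have -> : ps_map AA (eta, 0) = (ps_conn AA eta, act (ps_end AA) eta).
      by rewrite /ps_map /= wedge0r (conn0 AA) addr0 subr0.
    by rewrite iterS !H // (glin0 tF) addr0.
  split; apply: op_identified0 => eta Oe; have [K1 K2] := K eta Oe;
    have Oc := Omega_conn AA Oe; have OB := Omega_B AA Oe.
    rewrite /pbracket1 /scomm big_bool /= pF pF1 !act0l (conn0 AA) scaler0 subr0 add0r.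
    rewrite expr0 scale1r act_wedgel -!FoE // -GoE // -K1.
    by rewrite opprD addrA addrN add0r addNr.
  rewrite /pbracket2 /scomm big_bool /= pG pG0 !act0l (conn0 AA) scaler0 subr0 addr0.
  rewrite expr1 scaleN1r opprK -!FoE // -!GoE // opprD addrACA K2.
  by rewrite -opprD [Fo _ + _]addrC addrN.
Qed.
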